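(* Let $\Bbbk$ be a field and let $A$ be a connected $\mathbb N$-graded $\Bbbk$-algebra which is $N$-Koszul for some $N\geq 2$ and AS-Gorenstein of global dimension $n$. Let $\varepsilon$ and $\phi$ be the automorphisms of the graded algebra $A$ described in the context. Then $A$ is Calabi-Yau if and only if $\varepsilon^{n+1}\phi=\mathrm{id}_A$.
   Context: $A$ connected means $A_0=\Bbbk$. Shifts: $M(\ell)_i=M_{i+\ell}$. Let $\zeta_N(2j)=Nj$ and $\zeta_N(2j+1)=Nj+1$ (the jump function). $A$ is $N$-Koszul if it is generated by a finite-dimensional $V=A_1$ with relations homogeneous of degree $N$, and in the minimal graded projective resolution of the trivial module $\Bbbk$ the $i$-th term is generated in degree $\zeta_N(i)$ for all $i$. $A$ is AS-Gorenstein of global dimension $n$ (with $n\geq1$) if it has global dimension $n$ and $\mathrm{Ext}^i_A(\Bbbk,A)$ is $0$ for $i\neq n$ and is isomorphic to a shift $\Bbbk(\ell)$ for $i=n$. $A$ is Calabi-Yau of dimension $d\geq 1$ (Ginzburg) if it has a finite-length projective $A$-bimodule resolution by finitely generated bimodules and $\mathrm{Ext}^k_{A-A}(A,A\otimes A)\cong A$ as bimodules for $k=d$ and is $0$ for $k\neq d$; here $A\otimes A$ carries the outer structure $a(x\otimes y)b=ax\otimes yb$ when computing Ext, and the Ext spaces are bimodules through the inner structure $a(x\otimes y)b=xb\otimes ay$. Calabi-Yau means Calabi-Yau of some dimension $d$. Automorphisms. $\varepsilon$ is the automorphism $\varepsilon(a)=(-1)^{\deg a}a$ for homogeneous $a$.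 Let $E(A)=\bigoplus_i \mathrm{Ext}^i_A(\Bbbk,\Bbbk)$ be the Yoneda algebra; since $A$ is a connected $\mathbb N$-graded $\Bbbk$-algebra which is $N$-Koszul for some $N\geq 2$ and AS-Gorenstein of global dimension $n$, it is a (graded) Frobenius algebra with $E(A)_n$ one-dimensional, and, fixing $E(A)_n\cong\Bbbk$, the Frobenius pairing $(x,y)$ is the product $xy\in E(A)_n\cong\Bbbk$ for $x\in E(A)_i$, $y\in E(A)_{n-i}$. The Nakayama automorphism $\nu$ is defined by $(x,y)=(y,\nu(x))$; its component $\nu_1$ acts on $E(A)_1=V^*$. $\phi$ is the unique automorphism of the graded algebra $A$ whose restriction $\phi_1$ to $V=A_1$ is the transpose of $\nu_1$. It is known (Berger–Marconnet), and may be used, that for every connected $\mathbb N$-graded $\Bbbk$-algebra $A$ which is $N$-Koszul for some $N\geq 2$ and AS-Gorenstein of global dimension $n$, one has $\mathrm{Ext}^i_{A-A}(A,A\otimes A)=0$ for $i\neq n$ and $\mathrm{Ext}^n_{A-A}(A,A\otimes A)\cong {}_{\varepsilon^{n+1}\phi}A(\zeta_N(n))$ as graded bimodules, where ${}_\psi A$ is $A$ with left action $a\cdot x=\psi(a)x$ and the usual right action. *)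

(* Defs.v *)
From HB Require Import structures.
From mathcomp Require Import all_boot all_order all_algebra boolp.

Set Implicit Arguments.
Unset Strict Implicit.
Unset Printing Implicit Defensive.

Import GRing.Theory.
Local Open Scope ring_scope.
Local Open Scope quotient_scope.

(* [tens V W] is the set of finite formal sums of pairs, i.e. sequences,      *)
(* modulo the equations that hold after applying every bilinear map; this is  *)
(* the congruence generated by bilinearity (take the universal bilinear map). *)

Section Tensor.
Variables (k : fieldType) (V W : lmodType k).

Definition bilinear_map (U : lmodType k) (b : V -> W -> U) : Prop :=
  (forall w, linear (b^~ w)) /\ (forall v, linear (b v)).

Definition sum_of (U : lmodType k) (b : V -> W -> U) (s : seq (V * W)) : U :=
  \sum_(u <- s) b u.1 u.2.

Definition tens_rel (s t : seq (V * W)) : bool :=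
  `[< forall (U : lmodType k) (b : V -> W -> U),
        bilinear_map b -> sum_of b s = sum_of b t >].

Lemma tens_rel_equiv : equiv_class_of tens_rel.
Proof.
split=> [s|s t|s t r].
- by apply/asboolP.
- by apply/asboolP/asboolP => H U b Hb; rewrite H.
- by move=> /asboolP H1 /asboolP H2; apply/asboolP => U b Hb; rewrite H1 ?H2.
Qed.

Canonical tens_equiv := EquivRelPack tens_rel_equiv.

Definition tens : Type := {eq_quot tens_equiv}.
HB.instance Definition _ : EqQuotient _ tens_equiv tens := EqQuotient.on tens.
HB.instance Definition _ := Choice.on tens.

Definition tens_class (s : seq (V * W)) : tens := \pi_tens s.

Definition pure (v : V) (w : W) : tens := tens_class [:: (v, w)].

(* The linear map tens V W -> U induced by a bilinear map b. *)
Definition tens_lift (U : lmodType k) (b : V -> W -> U) (t : tens) : U :=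
  sum_of b (repr t).

Lemma tens_lift_pi (U : lmodType k) (b : V -> W -> U) s :
  bilinear_map b -> tens_lift b (tens_class s) = sum_of b s.
Proof.
move=> Hb; rewrite /tens_lift.
have /eqmodP/asboolP H : repr (tens_class s) = s %[mod tens] by rewrite reprK.
exact: H.
Qed.

Lemma tens_eqP (x y : tens) :
  (forall (U : lmodType k) (b : V -> W -> U),
     bilinear_map b -> tens_lift b x = tens_lift b y) -> x = y.
Proof.
by move=> H; rewrite -[x]reprK -[y]reprK; apply/eqmodP/asboolP => U b /H.
Qed.

Definition tens_zero : tens := tens_class [::].
Definition tens_add (x y : tens) : tens := tens_class (repr x ++ repr y).
Definition tens_scale (c : k) (x : tens) : tens :=
  tens_class [seq (c *: u.1, u.2) | u <- repr x].
Definition tens_opp (x : tens) : tens := tens_scale (-1) x.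

Lemma bilinear0l (U : lmodType k) (b : V -> W -> U) c v w :
  bilinear_map b -> b (c *: v) w = c *: b v w.
Proof. by case=> H _; exact: (scalable_linear (H w)). Qed.

Lemma tens_lift0 (U : lmodType k) (b : V -> W -> U) :
  bilinear_map b -> tens_lift b tens_zero = 0.
Proof. by move=> Hb; rewrite tens_lift_pi // /sum_of big_nil. Qed.

Lemma tens_liftD (U : lmodType k) (b : V -> W -> U) x y :
  bilinear_map b -> tens_lift b (tens_add x y) = tens_lift b x + tens_lift b y.
Proof. by move=> Hb; rewrite tens_lift_pi // /sum_of big_cat. Qed.

Lemma tens_liftZ (U : lmodType k) (b : V -> W -> U) c x :
  bilinear_map b -> tens_lift b (tens_scale c x) = c *: tens_lift b x.
Proof.
move=> Hb; rewrite tens_lift_pi // /tens_lift /sum_of big_map scaler_sumr.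
by apply: eq_bigr => u _; rewrite bilinear0l.
Qed.

Fact tens_addA : associative tens_add.
Proof. by move=> x y z; apply: tens_eqP => U b Hb; rewrite !tens_liftD // addrA. Qed.
Fact tens_addC : commutative tens_add.
Proof. by move=> x y; apply: tens_eqP => U b Hb; rewrite !tens_liftD // addrC. Qed.
Fact tens_add0 : left_id tens_zero tens_add.
Proof.
by move=> x; apply: tens_eqP => U b Hb; rewrite tens_liftD // tens_lift0 ?add0r.
Qed.
Fact tens_addN : left_inverse tens_zero tens_opp tens_add.
Proof.
move=> x; apply: tens_eqP => U b Hb.
by rewrite tens_liftD // tens_liftZ // tens_lift0 // scaleN1r addNr.
Qed.

HB.instance Definition _ :=
  GRing.isZmodule.Build tens tens_addA tens_addC tens_add0 tens_addN.

Fact tens_scaleA a b x : tens_scale a (tens_scale b x) = tens_scale (a * b) x.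
Proof. by apply: tens_eqP => U g Hg; rewrite !tens_liftZ // scalerA. Qed.
Fact tens_scale1 : left_id 1 tens_scale.
Proof. by move=> x; apply: tens_eqP => U g Hg; rewrite tens_liftZ // scale1r. Qed.
Fact tens_scaleDr : right_distributive tens_scale +%R.
Proof.
move=> a x y; apply: tens_eqP => U g Hg.
by rewrite tens_liftZ // !tens_liftD // !tens_liftZ // scalerDr.
Qed.
Fact tens_scaleDl x : {morph tens_scale^~ x : a b / a + b}.
Proof.
move=> a b; apply: tens_eqP => U g Hg.
by rewrite tens_liftD // !tens_liftZ // scalerDl.
Qed.

HB.instance Definition _ :=
  GRing.Zmodule_isLmodule.Build k tens
    tens_scaleA tens_scale1 tens_scaleDr tens_scaleDl.

Lemma tens_lift_linear (U : lmodType k) (b : V -> W -> U) :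
  bilinear_map b -> linear (tens_lift b).
Proof. by move=> Hb c x y; rewrite tens_liftD // tens_liftZ. Qed.

Lemma tens_lift_pure (U : lmodType k) (b : V -> W -> U) v w :
  bilinear_map b -> tens_lift b (pure v w) = b v w.
Proof. by move=> Hb; rewrite tens_lift_pi // /sum_of big_seq1. Qed.

Lemma pure_bilinear : bilinear_map pure.
Proof.
split=> x c u v; apply: tens_eqP => U b Hb;
  rewrite tens_lift_linear // !tens_lift_pure //.
- by case: Hb => H _; rewrite H.
- by case: Hb => _ H; rewrite H.
Qed.

Lemma tens_sum_pure (t : tens) : exists s, t = \sum_(u <- s) pure u.1 u.2.
Proof.
exists (repr t); apply: tens_eqP => U b Hb; rewrite {1}/tens_lift /sum_of.
elim: (repr t) => [|u s IH]; first by rewrite !big_nil tens_lift0.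
by rewrite !big_cons tens_liftD // -IH tens_lift_pure.
Qed.

End Tensor.

(* f (x) g *)
Definition tens_map (k : fieldType) (V W : lmodType k)
    (f : V -> V) (g : W -> W) (t : tens V W) : tens V W :=
  tens_lift (fun v w => pure (f v) (g w)) t.

Lemma bilinear_comp (k : fieldType) (V W U : lmodType k) (b : V -> W -> U)
    (f : V -> V) (g : W -> W) : linear f -> linear g -> bilinear_map b ->
  bilinear_map (fun v w => b (f v) (g w)).
Proof.
by move=> Hf Hg [H1 H2]; split=> x c u v; rewrite ?Hf ?Hg (H1, H2).
Qed.

Lemma tens_lift_map (k : fieldType) (V W U : lmodType k) (b : V -> W -> U)
    (f : V -> V) (g : W -> W) t :
  linear f -> linear g -> bilinear_map b ->
  tens_lift b (tens_map f g t) = tens_lift (fun v w => b (f v) (g w)) t.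
Proof.
move=> Hf Hg Hb; have Hp := bilinear_comp Hf Hg (pure_bilinear V W).
have Hq := bilinear_comp Hf Hg Hb.
have [s ->] := tens_sum_pure t; rewrite /tens_map.
elim: s => [|u s IH]; first by rewrite !big_nil !(tens_lift0 _).
rewrite !big_cons !(tens_liftD _ _ Hp) !(tens_liftD _ _ Hb) !(tens_liftD _ _ Hq).
by rewrite IH !tens_lift_pure.
Qed.

Record bimodule (k : fieldType) (A : algType k) := Bimodule {
  bi_car :> lmodType k;
  lact : A -> bi_car -> bi_car;
  ract : bi_car -> A -> bi_car;
  lact_linear1 : forall x, linear (lact^~ x);
  lact_linear2 : forall a, linear (lact a);
  ract_linear1 : forall a, linear (ract^~ a);
  ract_linear2 : forall x, linear (ract x);
  lact1 : forall x, lact 1 x = x;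
  lactM : forall a b x, lact (a * b) x = lact a (lact b x);
  ract1 : forall x, ract x 1 = x;
  ractM : forall a b x, ract x (a * b) = ract (ract x a) b;
  lact_ract : forall a b x, lact a (ract x b) = ract (lact a x) b
}.

Section BimoduleExamples.
Variables (k : fieldType) (A : algType k).

Lemma mull_linear (a : A) : linear (fun x : A => a * x).
Proof. by move=> c x y; rewrite mulrDr scalerAr. Qed.
Lemma mulr_linear' (a : A) : linear (fun x : A => x * a).
Proof. by move=> c x y; rewrite mulrDl scalerAl. Qed.

(* The bimodule _psi A; [twisted idfun] is A itself. *)
Section Twisted.
Variable psi : {lrmorphism A -> A}.
Fact twisted_linear1 (x : A) : linear (fun a => psi a * x).
Proof. by move=> c a b; rewrite linearP mulrDl scalerAl. Qed.
Fact twisted1 (x : A) : psi 1 * x = x. Proof. by rewrite rmorph1 mul1r. Qed.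
Fact twistedM (a b x : A) : psi (a * b) * x = psi a * (psi b * x).
Proof. by rewrite rmorphM mulrA. Qed.

Definition twisted : bimodule A :=
  @Bimodule k A A (fun a x => psi a * x) (fun x a => x * a)
    twisted_linear1 (fun a => mull_linear (psi a))
    mulr_linear' mull_linear twisted1 twistedM (@mulr1 A)
    (fun a b x => mulrA x a b) (fun a b x => mulrA (psi a) x b).
End Twisted.

Definition regular : bimodule A := twisted idfun.

(* a (x (x) y) b = ax (x) yb *)
Definition louter (a : A) (t : tens A A) := tens_map ( *%R a) id t.
Definition router (t : tens A A) (b : A) := tens_map id ( *%R^~ b) t.
(* a (x (x) y) b = xb (x) ay *)
Definition linner (a : A) (t : tens A A) := tens_map id ( *%R a) t.
Definition rinner (t : tens A A) (b : A) := tens_map ( *%R^~ b) id t.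

Let idl : linear (@id A). Proof. by []. Qed.

Fact tens_map_linear (f g : A -> A) :
  linear f -> linear g -> linear (@tens_map k A A f g).
Proof.
move=> Hf Hg; apply: tens_lift_linear.
exact: bilinear_comp (pure_bilinear A A).
Qed.

Fact louter_linear1 t : linear (louter^~ t).
Proof.
move=> c a b; apply: tens_eqP => U g Hg.
have Hm x := bilinear_comp (mull_linear x) idl Hg.
rewrite tens_lift_linear // !tens_lift_map //; try exact: mull_linear.
rewrite /tens_lift /sum_of scaler_sumr -big_split; apply: eq_bigr => u _ /=.
by rewrite mulrDl -scalerAl; case: Hg => H _; rewrite H.
Qed.

Fact router_linear2 t : linear (router t).
Proof.
move=> c a b; apply: tens_eqP => U g Hg.
rewrite tens_lift_linear // !tens_lift_map //; try exact: mulr_linear'.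
rewrite /tens_lift /sum_of scaler_sumr -big_split; apply: eq_bigr => u _ /=.
by rewrite mulrDr -scalerAr; case: Hg => _ H; rewrite H.
Qed.

Fact louter1 t : louter 1 t = t.
Proof.
apply: tens_eqP => U g Hg; rewrite tens_lift_map //; last exact: mull_linear.
by apply: eq_bigr => u _; rewrite mul1r.
Qed.

Fact router1 t : router t 1 = t.
Proof.
apply: tens_eqP => U g Hg; rewrite tens_lift_map //; last exact: mulr_linear'.
by apply: eq_bigr => u _; rewrite mulr1.
Qed.

Fact louterM a b t : louter (a * b) t = louter a (louter b t).
Proof.
apply: tens_eqP => U g Hg.
rewrite !tens_lift_map //; try exact: mull_linear.
- by apply: eq_bigr => u _; rewrite mulrA.
- exact: (bilinear_comp (mull_linear a) idl Hg).
Qed.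

Fact routerM a b t : router t (a * b) = router (router t a) b.
Proof.
apply: tens_eqP => U g Hg.
rewrite !tens_lift_map //; try exact: mulr_linear'.
- by apply: eq_bigr => u _; rewrite mulrA.
- exact: (bilinear_comp idl (mulr_linear' b) Hg).
Qed.

Fact louter_router a b t : louter a (router t b) = router (louter a t) b.
Proof.
apply: tens_eqP => U g Hg.
rewrite !tens_lift_map //; try exact: mulr_linear'; try exact: mull_linear.
- exact: (bilinear_comp idl (mulr_linear' b) Hg).
- exact: (bilinear_comp (mull_linear a) idl Hg).
Qed.

(* A (x) A with its outer structure *)
Definition outer : bimodule A :=
  @Bimodule k A (tens A A) louter router
    louter_linear1 (fun a => tens_map_linear (mull_linear a) idl)
    (fun a => tens_map_linear idl (mulr_linear' a)) router_linear2
    louter1 louterM router1 routerM louter_router.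

End BimoduleExamples.

(* Cohomology of a cochain complex of homomorphisms into N: [hom i] singles   *)
(* out the homomorphisms P i -> N.  Cohomology groups are handled through     *)
(* cocycles modulo coboundaries, without forming the quotient.                *)

Section Cochains.
Variables (P : nat -> zmodType) (d : forall i, P i.+1 -> P i) (N : zmodType).
Variable hom : forall i, (P i -> N) -> Prop.

Definition is_cocycle i (f : P i -> N) : Prop :=
  hom f /\ forall y, f (d y) = 0.

Definition is_coboundary i : (P i -> N) -> Prop :=
  match i with
  | 0 => fun f => forall x, f x = 0
  | j.+1 => fun f => exists2 g : P j -> N, hom g & forall x, f x = g (d x)
  end.

Definition cohomology_vanishes i : Prop :=
  forall f : P i -> N, is_cocycle f -> is_coboundary f.

(* theta induces an isomorphism of abelian groups from H^i onto E *)
Definition cohomology_iso i (E : zmodType) (theta : (P i -> N) -> E) : Prop :=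
  [/\ forall f g, is_cocycle f -> is_cocycle g ->
        theta (fun x => f x + g x) = theta f + theta g,
      forall e, exists2 f, is_cocycle f & theta f = e
    & forall f, is_cocycle f -> (theta f = 0 <-> is_coboundary f)].

End Cochains.

Definition projective (R : pzRingType) (P : lmodType R) : Prop :=
  forall (M N : lmodType R) (g : {linear M -> N}) (f : {linear P -> N}),
    (forall y, exists x, g x = y) ->
    exists h : {linear P -> M}, forall p, g (h p) = f p.

Record resolution (R : pzRingType) (M : lmodType R) := Resolution {
  res :> nat -> lmodType R;
  res_d : forall i, {linear res i.+1 -> res i};
  res_aug : {linear res 0 -> M};
  res_projective : forall i, projective (res i);
  res_surj : forall x, exists y, res_aug y = x;
  res_exact0 : forall x, res_aug x = 0 <-> exists y, res_d 0 y = x;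
  res_exact : forall i x, res_d i x = 0 <-> exists y, res_d i.+1 y = x
}.
Arguments res_d {R M} r i.

Definition gldim_le (R : pzRingType) (n : nat) : Prop :=
  forall M : lmodType R, exists P : resolution M,
    forall i, (n < i)%N -> forall x : P i, x = 0.

Definition global_dimension (R : pzRingType) (n : nat) : Prop :=
  gldim_le R n /\ forall m, (m < n)%N -> ~ gldim_le R m.

(* V is the direct sum of its subgroups G i. *)
Definition direct_decomposition (I : eqType) (V : zmodType)
    (G : I -> V -> Prop) : Prop :=
  [/\ forall i, G i 0,
      forall i x y, G i x -> G i y -> G i (x - y),
      forall x, exists (s : seq I) (c : I -> V),
        (forall i, G i (c i)) /\ x = \sum_(i <- s) c i
    & forall (s : seq I) (c : I -> V), uniq s -> (forall i, G i (c i)) ->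
        \sum_(i <- s) c i = 0 -> forall i, i \in s -> c i = 0].

(* Connected N-graded algebras.  The augmentation [cg_aug], the projection    *)
(* onto A_0 = k, is determined by the other fields.                           *)
Record cgAlg (k : fieldType) := CGAlg {
  cg_alg :> algType k;
  cg_comp : nat -> cg_alg -> Prop;
  cg_aug : {rmorphism cg_alg -> k};
  cg_decomposition : direct_decomposition cg_comp;
  cg_compZ : forall i (c : k) a, cg_comp i a -> cg_comp i (c *: a);
  cg_compM : forall i j a b,
    cg_comp i a -> cg_comp j b -> cg_comp (i + j)%N (a * b);
  cg_connected : forall a, cg_comp 0 a <-> exists c : k, a = c%:A;
  cg_aug_scalar : forall c : k, cg_aug c%:A = c;
  cg_aug_pos : forall i a, cg_comp i.+1 a -> cg_aug a = 0
}.

(* the trivial module k *)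
Definition trivial (k : fieldType) (A : cgAlg k) : Type := k.

Section GradedModules.
Variables (k : fieldType) (A : cgAlg k).

(* Z-graded components of A: zero in negative degrees *)
Definition zcomp (m : int) (a : A) : Prop :=
  match m with Posz i => cg_comp i a | Negz _ => a = 0 end.

Definition module_grading (M : lmodType A) (G : int -> M -> Prop) : Prop :=
  direct_decomposition G /\
  forall i m (a : A) x, cg_comp i a -> G m x -> G (i%:Z + m) (a *: x).

HB.instance Definition _ := GRing.Zmodule.on (trivial A).

Definition triv_scale (a : A) (x : trivial A) : trivial A := cg_aug A a * (x : k).
Fact triv_scaleA a b x : triv_scale a (triv_scale b x) = triv_scale (a * b) x.
Proof. by rewrite /triv_scale rmorphM mulrA. Qed.
Fact triv_scale1 : left_id 1 triv_scale.
Proof. by move=> x; rewrite /triv_scale rmorph1 mul1r. Qed.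
Fact triv_scaleDr : right_distributive triv_scale +%R.
Proof. by move=> a x y; rewrite /triv_scale mulrDr. Qed.
Fact triv_scaleDl x : {morph triv_scale^~ x : a b / a + b}.
Proof. by move=> a b; rewrite /triv_scale rmorphD mulrDl. Qed.
HB.instance Definition _ := GRing.Zmodule_isLmodule.Build A (trivial A)
  triv_scaleA triv_scale1 triv_scaleDr triv_scaleDl.

Definition graded_resolution (P : resolution (trivial A))
    (G : forall i, int -> P i -> Prop) : Prop :=
  [/\ forall i, module_grading (G i),
      forall i m y, G i.+1 m y -> G i m (res_d P i y)
    & forall m x, G 0%N m x -> m != 0 -> res_aug P x = 0].

(* d (P i.+1) is contained in A_+ (P i), where A_+ = ker cg_aug *)
Definition minimal_resolution (P : resolution (trivial A)) : Prop :=
  forall i (y : P i.+1), exists s : seq (A * P i),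
    (forall u, u \in s -> cg_aug A u.1 = 0) /\
    res_d P i y = \sum_(u <- s) u.1 *: u.2.

Definition generated_in_degree (M : lmodType A) (G : int -> M -> Prop)
    (m : int) : Prop :=
  forall x : M, exists s : seq (A * M),
    (forall u, u \in s -> G m u.2) /\ x = \sum_(u <- s) u.1 *: u.2.

End GradedModules.

(* zeta_N *)
Definition jump (N i : nat) : nat := (N * i./2 + odd i)%N.

Section Koszul.
Variables (k : fieldType) (A : cgAlg k).

(* the value at (b_i) of a homogeneous noncommutative polynomial of degree N, *)
(* given by its coefficients on the words of length N                         *)
Definition eval_rel (N r : nat) (B : algType k) (b : 'I_r -> B)
    (rho : {ffun N.-tuple 'I_r -> k}) : B :=
  \sum_w rho w *: \prod_(i <- w) b i.

(* A_1 has a finite basis e, and A is the algebra presented by the generators *)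
(* e and a set of relations R, all homogeneous of degree N.                   *)
Definition presented_in_degree (N : nat) : Prop :=
  exists (r : nat) (e : 'I_r -> A) (R : {ffun N.-tuple 'I_r -> k} -> Prop),
  [/\ forall i, cg_comp 1 (e i),
      forall v : A, cg_comp 1 v ->
        exists! c : {ffun 'I_r -> k}, v = \sum_i c i *: e i,
      forall a : A, exists s : seq (k * seq 'I_r),
        a = \sum_(u <- s) u.1 *: \prod_(i <- u.2) e i,
      forall rho, R rho -> eval_rel e rho = 0
    & forall (B : algType k) (b : 'I_r -> B),
        (forall rho, R rho -> eval_rel b rho = 0) ->
        exists f : {lrmorphism A -> B}, forall i, f (e i) = b i].

Definition N_Koszul (N : nat) : Prop :=
  presented_in_degree N /\
  exists (P : resolution (trivial A)) (G : forall i, int -> P i -> Prop),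
    [/\ graded_resolution G, minimal_resolution P
      & forall i, generated_in_degree (G i) (jump N i)%:Z].

End Koszul.

Section Gorenstein.
Variables (k : fieldType) (A : cgAlg k).

Definition cochain_to_A (P : resolution (trivial A)) i (f : P i -> A) : Prop :=
  linear (f : P i -> A^o).

(* Ext_A^i(k, A) is computed with a graded projective resolution P of k.  The *)
(* last clauses say that the isomorphism Ext_A^n(k, A) -> k(l) is one of      *)
(* right A-modules and respects degrees: k(l) lives in degree -l.             *)
Definition AS_Gorenstein (n : nat) : Prop :=
  [/\ (0 < n)%N, global_dimension A n
    & exists (P : resolution (trivial A)) (G : forall i, int -> P i -> Prop),
      [/\ graded_resolution G,
          forall i, i != n ->
            cohomology_vanishes (res_d P) (@cochain_to_A P) i
        & exists (l : int) (theta : (P n -> A) -> k),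
          [/\ cohomology_iso (res_d P) (@cochain_to_A P) theta,
              forall f a, is_cocycle (res_d P) (@cochain_to_A P) f ->
                theta (fun x => f x * a) = theta f * cg_aug A a
            & forall f (m : int), is_cocycle (res_d P) (@cochain_to_A P) f ->
                (forall j x, G n j x -> zcomp (j + m) (f x)) ->
                m != - l -> theta f = 0]]].

End Gorenstein.

Section Yoneda.
Variables (k : fieldType) (A : cgAlg k) (P : resolution (trivial A)).

Definition cochain_to_k i (f : P i -> trivial A) : Prop := linear f.

(* representatives of the elements of E(A)_i = Ext_A^i(k, k) *)
Definition E_cocycle i (f : P i -> trivial A) : Prop :=
  is_cocycle (res_d P) cochain_to_k f.

(* L is a chain map P[j] -> P lifting g : P j -> k *)
Definition chain_lift j (g : P j -> trivial A)
    (L : forall m, P (m + j)%N -> P m) : Prop :=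
  [/\ forall m, linear (@L m),
      forall x, res_aug P (L 0%N x) = g x
    & forall m (x : P (m.+1 + j)%N),
        res_d P m (L m.+1 x) = L m (res_d P (m + j) x)].

(* h represents the Yoneda product of the classes of f and g, that is, the    *)
(* composite k -> k[j] -> k[i + j] of g followed by f.  For N = 2 the algebra *)
(* E(A) is then the quadratic dual of A for (f g)(v (x) w) = f(v) g(w).       *)
Definition yoneda_product i j (f : P i -> trivial A) (g : P j -> trivial A)
    (h : P (i + j)%N -> trivial A) : Prop :=
  exists2 L, chain_lift g L & forall x, h x = f (L i x).

(* nu acts on representatives.  [tr n] is the identification E(A)_n ~ k; it   *)
(* is given as a family to avoid transports along i + j = n.  As the pairing  *)
(* is non-degenerate, (x, y) = (y, nu x) determines nu on classes.            *)
Definition is_Nakayama (n : nat)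
    (nu : forall i, (P i -> trivial A) -> P i -> trivial A) : Prop :=
  (forall i f, @E_cocycle i f -> E_cocycle (nu i f)) /\
  exists tr : forall m, (P m -> trivial A) -> k,
  [/\ cohomology_iso (res_d P) cochain_to_k (tr n),
      forall (c : k) f, E_cocycle f -> tr n (fun x => c * f x) = c * tr n f
    & forall i j, (i + j)%N = n ->
      forall (x : P i -> trivial A) (y : P j -> trivial A),
      E_cocycle x -> E_cocycle y -> forall xy ynux,
      yoneda_product x y xy -> yoneda_product y (nu i x) ynux ->
      tr (i + j)%N xy = tr (j + i)%N ynux].

(* The identification E(A)_1 = V^*: the linear form on V = A_1 given by the   *)
(* class of f has value c at v.                                               *)
Definition E1_value (f : P 1 -> trivial A) (v : A) (c : k) : Prop :=
  exists (p0 : P 0) (p1 : P 1),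
    [/\ res_aug P p0 = (1 : k), res_d P 0 p1 = v *: p0 & f p1 = c].

End Yoneda.

Section Automorphisms.
Variables (k : fieldType) (A : cgAlg k).

Definition graded_automorphism (f : {lrmorphism A -> A}) : Prop :=
  bijective f /\ forall i a, cg_comp i a -> cg_comp i (f a).

Definition is_epsilon (eps : {lrmorphism A -> A}) : Prop :=
  forall i a, cg_comp i a -> eps a = (-1) ^+ i * a.

Definition is_phi (n : nat) (phi : {lrmorphism A -> A}) : Prop :=
  graded_automorphism phi /\
  exists (P : resolution (trivial A))
         (nu : forall i, (P i -> trivial A) -> P i -> trivial A),
    is_Nakayama n nu /\
    forall f v c, @E_cocycle k A P 1 f -> cg_comp 1 v ->
      E1_value (nu 1%N f) v c -> E1_value f (phi v) c.

Fixpoint lrpow (f : {lrmorphism A -> A}) (n : nat) : {lrmorphism A -> A} :=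
  if n is m.+1 then f \o lrpow f m else idfun.

End Automorphisms.

Section BimoduleHomology.
Variables (k : fieldType) (A : algType k).

Definition bihom (M N : bimodule A) (f : M -> N) : Prop :=
  [/\ linear f, forall a x, f (lact a x) = lact a (f x)
    & forall x a, f (ract x a) = ract (f x) a].

Definition biprojective (P : bimodule A) : Prop :=
  forall (M N : bimodule A) (g : M -> N) (f : P -> N),
    bihom g -> bihom f -> (forall y, exists x, g x = y) ->
    exists2 h : P -> M, bihom h & forall p, g (h p) = f p.

Definition bi_finitely_generated (M : bimodule A) : Prop :=
  exists gens : seq M, forall x : M, exists s : seq (A * M * A),
    (forall u, u \in s -> u.1.2 \in gens) /\
    x = \sum_(u <- s) ract (lact u.1.1 u.1.2) u.2.

Record biresolution := Biresolution {
  bres :> nat -> bimodule A;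
  bres_d : forall i, bres i.+1 -> bres i;
  bres_aug : bres 0 -> regular A;
  bres_d_hom : forall i, bihom (@bres_d i);
  bres_aug_hom : bihom bres_aug;
  bres_projective : forall i, biprojective (bres i);
  bres_surj : forall x, exists y, bres_aug y = x;
  bres_exact0 : forall x, bres_aug x = 0 <-> exists y, @bres_d 0 y = x;
  bres_exact : forall i x, @bres_d i x = 0 <-> exists y, @bres_d i.+1 y = x
}.

Definition bicochain (P : biresolution) i (f : P i -> tens A A) : Prop :=
  @bihom (P i) (outer A) f.

Definition biExt_vanishes (P : biresolution) (i : nat) : Prop :=
  cohomology_vanishes (@bres_d P) (@bicochain P) i.

(* theta induces an isomorphism of bimodules from Ext^i_{A-A}(A, A (x) A),    *)
(* with its inner structure, onto E.                                          *)
Definition biExt_iso (P : biresolution) (i : nat) (E : bimodule A)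
    (theta : (P i -> tens A A) -> E) : Prop :=
  [/\ cohomology_iso (@bres_d P) (@bicochain P) theta,
      forall f a, is_cocycle (@bres_d P) (@bicochain P) f ->
        theta (fun x => linner a (f x)) = lact a (theta f)
    & forall f a, is_cocycle (@bres_d P) (@bicochain P) f ->
        theta (fun x => rinner (f x) a) = ract (theta f) a].

Definition Calabi_Yau_dim (d : nat) : Prop :=
  (0 < d)%N /\
  exists P : biresolution,
    [/\ exists l, forall i, (l < i)%N -> forall x : P i, x = 0,
        forall i, bi_finitely_generated (P i),
        forall i, i != d -> biExt_vanishes P i
      & exists theta, @biExt_iso P d (regular A) theta].

Definition Calabi_Yau : Prop := exists d, Calabi_Yau_dim d.

End BimoduleHomology.

Section GradedBimodules.
Variables (k : fieldType) (A : cgAlg k).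

Definition bimodule_grading (M : bimodule A) (G : int -> M -> Prop) : Prop :=
  [/\ direct_decomposition G,
      forall i m (a : A) x, cg_comp i a -> G m x -> G (i%:Z + m) (lact a x)
    & forall i m (a : A) x, cg_comp i a -> G m x -> G (m + i%:Z) (ract x a)].

Definition graded_biresolution (P : biresolution A)
    (G : forall i, int -> P i -> Prop) : Prop :=
  [/\ forall i, bimodule_grading (G i),
      forall i m y, G i.+1 m y -> G i m (@bres_d _ _ P i y)
    & forall m x, G 0%N m x -> zcomp m (@bres_aug _ _ P x : A)].

Definition tens_comp (m : int) (t : tens A A) : Prop :=
  exists s : seq (A * A),
    (forall u, u \in s -> exists i j,
       [/\ cg_comp i u.1, cg_comp j u.2 & m = (i + j)%N%:Z]) /\
    t = \sum_(u <- s) pure u.1 u.2.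

End GradedBimodules.

(* For every projective bimodule resolution P of A, the bimodule isomorphism  *)
(* Ext^n ~ _psi A, psi = eps^(n+1) phi, obtained from P has degree zeta_N(n)  *)
(* for any grading making P a graded resolution.                              *)
Definition Berger_Marconnet (k : fieldType) : Prop :=
  forall (A : cgAlg k) (N n : nat) (eps phi : {lrmorphism A -> A}),
    (1 < N)%N -> N_Koszul A N -> AS_Gorenstein A n ->
    is_epsilon eps -> is_phi n phi ->
    forall P : biresolution A,
    (forall i, i != n -> biExt_vanishes P i) /\
    exists theta : (P n -> tens A A) -> twisted (lrpow eps n.+1 \o phi),
      biExt_iso theta /\
      forall G : forall i, int -> P i -> Prop, graded_biresolution G ->
      forall f (m : int), is_cocycle (@bres_d _ _ P) (@bicochain _ _ P) f ->
        (forall j x, G n j x -> tens_comp (j + m) (f x)) ->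
        zcomp (m + (jump N n)%:Z) (theta f : A).

(* Main.v *)
From HB Require Import structures.
Require Import Defs.
From mathcomp Require Import all_boot all_order all_algebra boolp classical_sets.

(* By the Berger-Marconnet theorem Ext^i_{A-A}(A, A (x) A) vanishes for i != n  *)
(* and is _psi A for i = n, where psi = eps^(n+1) phi.  If A is Calabi-Yau of   *)
(* dimension d, then d = n, and the isomorphism A ~ _psi A sends 1 to some u    *)
(* with psi(a) u = u a and nonzero scalar part; psi being graded, the lowest    *)
(* degree part of this equation is psi(a) = a.                                  *)
(*                                                                              *)
(* Conversely, if psi = id, only a finite resolution of A by finitely generated *)
(* projective bimodules is missing.  The minimal resolution of k is free of     *)
(* finite rank, because its generators in step i + 1 embed by d into a          *)
(* homogeneous part of step i, and it stops after step n: comparing it with a   *)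
(* resolution of length n gives P_i = A_+ P_i for i > n.  It is lifted along    *)
(* - (x)_A k to a resolution of A by the free bimodules A^r (x) A.  The kernels *)
(* K of the lifted differentials are direct summands as right modules, so that  *)
(* an element of K which dies in - (x)_A k lies in K A_+; hence generators of   *)
(* K (x)_A k lift to generators of K by the graded Nakayama lemma.              *)

Set Implicit Arguments.
Unset Strict Implicit.
Unset Printing Implicit Defensive.

Import GRing.Theory.
Local Open Scope ring_scope.

(** * Linear maps and decompositions *)

(** The Berger-Marconnet hypothesis identifies Ext^n(A, A (x) A) with _psi A, psi = eps^(n+1) phi,
    from every projective bimodule resolution, so two questions remain: when _psi A is A, and
    whether a resolution with the required finiteness exists.

    For the first, [biExt_iso_eq] compares two identifications of the same Ext group without forming
    quotients. By [twisted_iso] the image u of 1 intertwines psi with the identity; 1 is a left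
    multiple of u, which makes the scalar part of u nonzero. As psi preserves degree,
    [twist_trivial] concludes.

    For the second, [koszul_free_resolution] writes the Koszul resolution of k as homogeneous
    matrices of finite size. Graded Nakayama arguments show that bases of the generating degree are
    free ([basis_free]) and that the ranks vanish beyond n ([nakayama_rank0] with
    [resolution_beyond_gldim]). Then [bimodule_resolution] lifts these matrices to maps of free
    bimodules. The induction, [syzygy_step], rests on one fact: every kernel is a direct summand on
    the right, so its image under - (x)_A k is the corresponding kernel over k, and surjectivity can
    be tested after that reduction ([syzygy_cover]). The finite ranks and the length n then give
    exactly what [Calabi_Yau_dim] demands besides the Ext groups. *)

Section LinearMaps.
Variables (R : pzRingType) (U V : lmodType R) (f : U -> V).
Hypothesis fL : linear f.

Lemma linD x y : f (x + y) = f x + f y.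
Proof. by rewrite -[x]scale1r fL !scale1r. Qed.
Lemma lin0 : f 0 = 0.
Proof. by apply: (addrI (f 0)); rewrite -linD !addr0. Qed.
Lemma linZ a x : f (a *: x) = a *: f x.
Proof. by rewrite -[a *: x]addr0 fL lin0 addr0. Qed.
Lemma linN x : f (- x) = - f x.
Proof. by rewrite -scaleN1r linZ scaleN1r. Qed.
Lemma linB x y : f (x - y) = f x - f y.
Proof. by rewrite linD linN. Qed.
Lemma lin_sum I (s : seq I) (P : pred I) (F : I -> U) :
  f (\sum_(i <- s | P i) F i) = \sum_(i <- s | P i) f (F i).
Proof. exact: (big_morph f linD lin0). Qed.

End LinearMaps.

Lemma lin_comp (R : pzRingType) (U V W : lmodType R) (f : U -> V) (g : W -> U) :
  linear f -> linear g -> linear (fun x => f (g x)).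
Proof. by move=> fL gL a x y; rewrite gL fL. Qed.

(* A maximal subspace meeting [ker g] trivially is a complement of it, and [g] *)
(* maps it bijectively onto its image.                                        *)
Lemma linear_lifting (k : fieldType) (V M N : lmodType k) (g : M -> N)
    (f : V -> N) :
  linear g -> linear f -> (forall v, exists m, g m = f v) ->
  exists2 h : V -> M, linear h & forall v, g (h v) = f v.
Proof.
move=> gL fL fg.
pose P (S : set M) := (forall c x y, S x -> S y -> S (c *: x + y)) /\
  (forall x, S x -> g x = 0 -> x = 0).
have [F FP Ftot|S [[SL S0] Smax]] := @Zorn_bigcup M P.
  split=> [c x y [X FX Xx] [Y FY Yy]|x [X FX Xx]]; last exact: (FP X FX).2.
  have [XY|YX] := Ftot X Y FX FY.
    by exists Y => //; apply: (FP Y FY).1 => //; apply: XY.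
  by exists X => //; apply: (FP X FX).1 => //; apply: YX.
(* [P] does not require 0, because the union of the empty chain must satisfy it; maximality supplies
   0 instead. *)
have S_0 : S 0.
  apply: contrapT => nS0; apply: (Smax [set x | S x \/ x = 0]%classic).
    split; first by move=> x Sx; left.
    by move=> /(_ 0) /= H; apply/nS0/H; right.
  split=> [c x y [Sx|->] [Sy|->] /=|x [|//] Sx] /=; last exact: S0.
  - by left; apply: SL.
  - by left; have := SL (c - 1) x x Sx Sx; rewrite -{2}[x]scale1r -scalerDl subrK addr0.
  - by left; rewrite scaler0 add0r.
  - by right; rewrite scaler0 addr0.
have SB x y : S x -> S y -> S (x - y).
  by move=> Sx Sy; rewrite addrC -scaleN1r; apply: SL.
have Simg v : exists m, S m /\ g m = f v.
  have [m gm] := fg v; apply: contrapT => nS.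
  have Sm s : S s -> g s <> g m by move=> Ss gs; apply: nS; exists s; rewrite gs.
  apply: (Smax [set x | exists s c, S s /\ x = s + c *: m]%classic).
    split; first by move=> x Sx; exists x, 0; rewrite scale0r addr0.
    move=> /(_ m) H; apply: (Sm m) => //; apply: H.
    by exists 0, 1; rewrite scale1r add0r.
  split=> [c _ _ [s [a [Ss ->]]] [t [b [St ->]]]|_ [s [a [Ss ->]]]].
    exists (c *: s + t), (c * a + b); split; first exact: SL.
    by rewrite scalerDr scalerA addrACA -scalerDl.
  rewrite (linD gL) (linZ gL); have [->|a0] := eqVneq a 0.
    by rewrite !scale0r !addr0; apply: S0.
  move=> /eqP; rewrite addr_eq0 => /eqP H; exfalso.
  apply: (Sm ((- a^-1) *: s)); first by rewrite -[_ *: s]addr0; apply: SL.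
  by rewrite (linZ gL) H scaleNr scalerN opprK scalerA mulVf // scale1r.
have [h hP] := choice Simg.
exists h => [c x y|v]; last exact: (hP v).2.
apply/eqP; rewrite -subr_eq0; apply/eqP/S0.
  by apply: SB; [case: (hP (c *: x + y))|apply: SL; [case: (hP x)|case: (hP y)]].
by rewrite (linB gL) gL !(hP _).2 fL subrr.
Qed.

(** Chain maps, homotopies and the bimodule resolution are all built degree by degree; [C] is the
    invariant that makes the next choice possible. *)
Lemma dependent_choice (T : nat -> Type) (C : forall j, T j -> Prop)
    (Rel : forall j, T j -> T j.+1 -> Prop) :
  (exists x, C 0%N x) ->
  (forall j x, C j x -> exists2 y, C j.+1 y & Rel j x y) ->
  exists x : forall j, T j,
    (forall j, C j (x j)) /\ forall j, Rel j (x j) (x j.+1).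
Proof.
move=> /cid[x0 C0] step.
have nxt j (u : {x : T j | C j x}) :
    {v : {y : T j.+1 | C j.+1 y} | Rel j (sval u) (sval v)}.
  by case: u => x Cx /=; have /cid2[y Cy Ry] := step j x Cx; exists (exist _ y Cy).
pose fix s j : {x : T j | C j x} :=
  if j is i.+1 then sval (nxt i (s i)) else exist _ x0 C0.
exists (fun j => sval (s j)); split=> j; first exact: (svalP (s j)).
exact: (svalP (nxt j (s j))).
Qed.

Section Decomposition.
Variables (I : eqType) (V : zmodType) (G : I -> V -> Prop).
Hypothesis dG : direct_decomposition G.

(** [direct_decomposition] allows repeated indices and leaves [c] free off the list. Without
    repetitions, and with [c] zero off [s], the family [c] is determined by [x]. *)
Definition decomposes (x : V) (c : I -> V) : Prop :=
  (forall i, G i (c i)) /\ exists s : seq I,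
    [/\ uniq s, forall i, i \notin s -> c i = 0 & x = \sum_(i <- s) c i].

Lemma sum_support (c : I -> V) (s s' : seq I) :
  uniq s -> uniq s' -> {subset s <= s'} -> (forall i, i \notin s -> c i = 0) ->
  \sum_(i <- s') c i = \sum_(i <- s) c i.
Proof.
move=> us us' ss' c0; rewrite (bigID (mem s)) /= [X in _ + X]big1 // addr0.
rewrite -big_filter; apply: perm_big; apply: uniq_perm => //.
  exact: filter_uniq.
move=> i; rewrite mem_filter /=; case: (boolP (i \in s)) => //= /ss'.
by [].
Qed.

Lemma decomposesB x y c d :
  decomposes x c -> decomposes y d -> decomposes (x - y) (fun i => c i - d i).
Proof.
case: dG => _ GB _ _ [Gc [s [us c0 ->]]] [Gd [t [ut d0 ->]]].
split=> [i|]; first exact: GB.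
have H i : (i \notin undup (s ++ t)) = (i \notin s) && (i \notin t).
  by rewrite mem_undup mem_cat negb_or.
exists (undup (s ++ t)); split=> [||].
- exact: undup_uniq.
- by move=> i; rewrite H => /andP[/c0 -> /d0 ->]; rewrite subr0.
rewrite sumrB; congr (_ - _); apply: esym.
  by apply: (sum_support us (undup_uniq _)) => // i si; rewrite mem_undup mem_cat si.
apply: (sum_support ut (undup_uniq _)) => // i si.
by rewrite mem_undup mem_cat si orbT.
Qed.

Lemma decomposes0 c : decomposes 0 c -> forall i, c i = 0.
Proof.
case: dG => _ _ _ Gu [Gc [s [us c0 /esym s0]]] i.
by case: (boolP (i \in s)) => [|/c0 //]; apply: Gu.
Qed.

Lemma decomposes_uniq x c d :
  decomposes x c -> decomposes x d -> forall i, c i = d i.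
Proof.
move=> xc xd i; apply/eqP; rewrite -subr_eq0; apply/eqP.
have := decomposesB xc xd; rewrite subrr => /decomposes0; exact.
Qed.

Lemma decomposes_hom i x : G i x -> decomposes x (fun j => if j == i then x else 0).
Proof.
case: dG => G0 _ _ _ Gx; split=> [j|]; first by case: eqP => [->|].
exists [:: i]; split=> // [j|]; first by rewrite inE => /negPf ->.
by rewrite big_seq1 eqxx.
Qed.

Lemma component_subproof x : exists c, decomposes x c.
Proof.
case: (dG) => G0 GB Gs _; have [s [c [Gc ->]]] := Gs x.
have GN i y : G i y -> G i (- y) by move=> Gy; rewrite -sub0r; apply: GB.
elim: s => [|i s [d dP]].
  by rewrite big_nil; exists (fun=> 0); split=> //; exists [::]; rewrite big_nil.
rewrite big_cons.
have := decomposesB (decomposes_hom (Gc i)) (decomposesB (decomposes_hom (G0 i)) dP).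
by rewrite sub0r opprK => H; eexists; exact: H.
Qed.

Definition component (i : I) (x : V) : V := sval (cid (component_subproof x)) i.

Lemma componentP x : decomposes x (component^~ x).
Proof. exact: svalP (cid (component_subproof x)). Qed.

Lemma component_in i x : G i (component i x).
Proof. by case: (componentP x). Qed.

Lemma componentB i x y : component i (x - y) = component i x - component i y.
Proof.
exact: decomposes_uniq (componentP _) (decomposesB (componentP x) (componentP y)) i.
Qed.

Lemma component0 i : component i 0 = 0.
Proof. by have := componentB i 0 0; rewrite !subrr. Qed.

Lemma componentD i x y : component i (x + y) = component i x + component i y.
Proof.
have H z : component i (- z) = - component i z.
  by rewrite -[- z]sub0r componentB component0 sub0r.
by rewrite -{1}[y]opprK componentB H opprK.
Qed.

Lemma component_sum i J (s : seq J) (P : pred J) (F : J -> V) :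
  component i (\sum_(j <- s | P j) F j) = \sum_(j <- s | P j) component i (F j).
Proof. exact: (big_morph _ (componentD i) (component0 i)). Qed.

Lemma component_hom i j x : G j x -> component i x = if i == j then x else 0.
Proof. by move=> Gx; apply: (decomposes_uniq (componentP x) (decomposes_hom Gx) i). Qed.

Lemma component_id i x : G i x -> component i x = x.
Proof. by move/(component_hom i) ->; rewrite eqxx. Qed.

Lemma componentE x : exists s, uniq s /\ x = \sum_(i <- s) component i x.
Proof. by case: (componentP x) => _ [s [us _ e]]; exists s. Qed.

End Decomposition.

Lemma component_bound (V : zmodType) (G : nat -> V -> Prop)
    (dG : direct_decomposition G) x :
  exists M, x = \sum_(i < M) component dG i x.
Proof.
case: (componentP dG x) => _ [s [us s0 e]].
exists (\max_(i <- s) i).+1; rewrite {1}e -(big_mkord xpredT (component dG ^~ x)).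
apply/esym/sum_support => //; first exact: iota_uniq.
move=> i si; rewrite mem_index_iota /= ltnS.
by rewrite (big_rem i si) /= leq_maxl.
Qed.

Lemma additive_sum (U V : zmodType) (f : U -> V) (I : Type) (s : seq I)
    (P : pred I) (F : I -> U) : {morph f : x y / x + y} ->
  f (\sum_(i <- s | P i) F i) = \sum_(i <- s | P i) f (F i).
Proof.
move=> fD; apply: (big_morph f fD).
by apply: (addrI (f 0)); rewrite -fD !addr0.
Qed.

Lemma eq_on_homogeneous (I : eqType) (V W : zmodType) (G : I -> V -> Prop)
    (f g : V -> W) :
  direct_decomposition G -> {morph f : x y / x + y} -> {morph g : x y / x + y} ->
  (forall i x, G i x -> f x = g x) -> f =1 g.
Proof.
move=> dG fD gD fg x; have [s [_ ->]] := componentE dG x.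
rewrite (additive_sum _ _ _ fD) (additive_sum _ _ _ gD).
by apply: eq_bigr => i _; apply: (fg i); apply: component_in.
Qed.

(** * Comparison of resolutions *)

Section Pullback.
Variables (R : pzRingType) (P X Y : lmodType R).
Variables (f : {linear P -> Y}) (d : {linear X -> Y}).

Definition pullback_pred : {pred (P * X)%type} := fun u => f u.1 == d u.2.

Fact pullback_submod : submod_closed pullback_pred.
Proof.
split=> [|a u v]; rewrite !unfold_in /= ?linear0 // => /eqP eu /eqP ev.
by rewrite !linearP eu ev.
Qed.
HB.instance Definition _ :=
  GRing.isSubmodClosed.Build R (P * X)%type pullback_pred pullback_submod.

Record pullback := Pullback
  { pullback_val : (P * X)%type; _ : pullback_val \in pullback_pred }.
HB.instance Definition _ := [isSub for pullback_val].
HB.instance Definition _ := [Choice of pullback by <:].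
HB.instance Definition _ := [SubChoice_isSubLmodule of pullback by <:].

End Pullback.

(** [projective] lifts only along surjections, and [d] need not be one. The pullback of [f] and [d]
    does surject onto P; a section of it followed by the projection to X is the lift. *)
Lemma projective_lift (R : pzRingType) (P X Y : lmodType R)
    (f : {linear P -> Y}) (d : {linear X -> Y}) :
  projective P -> (forall p, exists x, d x = f p) ->
  exists h : {linear P -> X}, forall p, d (h p) = f p.
Proof.
move=> projP fd.
pose M := pullback f d; pose v : {linear M -> (P * X)%type} := val.
have [p|h hP] := projP M P (fst \o v) idfun.
  have [x dx] := fd p; have H : (p, x) \in pullback_pred f d by rewrite unfold_in /= dx.
  by exists (Pullback H).
exists (snd \o v \o h) => p /=.
have := hP p; rewrite /v /=; case: (h p) => -[p' x] /=.
by rewrite unfold_in /= => /eqP <- ->.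
Qed.

Section Comparison.
Variables (R : pzRingType) (M : lmodType R) (P Q : resolution M).

Lemma resolution_lift : exists f : forall j, {linear P j -> Q j},
  (forall x, res_aug Q (f 0%N x) = res_aug P x) /\
  forall j x, res_d Q j (f j.+1 x) = f j (res_d P j x).
Proof.
(* The invariant says that cycles go to cycles; by exactness the next map can then be lifted. *)
pose C j : {linear P j -> Q j} -> Prop := match j with
  | 0 => fun f => forall x, res_aug Q (f x) = res_aug P x
  | i.+1 => fun f => forall x, res_d P i x = 0 -> res_d Q i (f x) = 0 end.
have [||f [Cf fd]] := @dependent_choice (fun j => {linear P j -> Q j}) C
    (fun j f g => forall x, res_d Q j (g x) = f (res_d P j x)).
- apply: projective_lift; first exact: res_projective.
  by move=> p; apply: res_surj.
- move=> j f Cf.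
  have [y|g gP] := projective_lift (f := f \o res_d P j) (d := res_d Q j) (@res_projective _ _ P j.+1).
    case: j f Cf y => [|j] f Cf y /=.
      by apply/res_exact0; rewrite Cf; apply/res_exact0; exists y.
    by apply/res_exact/Cf/res_exact; exists y.
  by exists g => // x dx; rewrite gP /= dx linear0.
by exists f; split; first exact: (Cf 0%N).
Qed.

End Comparison.

Lemma resolution_homotopy (R : pzRingType) (M : lmodType R) (P : resolution M)
    (f : forall j, {linear P j -> P j}) :
  (forall x, res_aug P (f 0%N x) = 0) ->
  (forall j x, res_d P j (f j.+1 x) = f j (res_d P j x)) ->
  exists h : forall j, {linear P j -> P j.+1}, forall j x,
    f j.+1 x = res_d P j.+1 (h j.+1 x) + h j (res_d P j x).
Proof.
move=> f0 fd.
have dd j x : res_d P j (res_d P j.+1 x) = 0 by apply/res_exact; exists x.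
(* The invariant says that [f j.+1 - h d] takes values in cycles, which are boundaries, so it lifts
   along the next differential. *)
pose C j (h : {linear P j -> P j.+1}) :=
  forall x, res_d P j (h (res_d P j x)) = f j (res_d P j x).
have [||h [Ch hd]] := @dependent_choice (fun j => {linear P j -> P j.+1}) C
  (fun j g h => forall x, f j.+1 x = res_d P j.+1 (h x) + g (res_d P j x)).
- have [p|h hP] := projective_lift (f := f 0%N) (d := res_d P 0%N) (@res_projective _ _ P 0%N).
    exact/res_exact0.
  by exists h => x; apply: hP.
- move=> j h Ch.
  have [p|g gP] := projective_lift (f := f j.+1 \- (h \o res_d P j)) (d := res_d P j.+1)
    (@res_projective _ _ P j.+1).
    by apply/res_exact; rewrite /= linearB /= Ch fd subrr.
  exists g => x; last by rewrite gP /= subrK.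
  by rewrite /C gP /= dd linear0 subr0.
by exists h.
Qed.

(** The identity minus the round trip through a resolution of length n is null-homotopic, and the
    round trip is zero in degree [j.+1 > n]. *)
Lemma resolution_beyond_gldim (R : pzRingType) (n : nat) (M : lmodType R)
    (P : resolution M) : gldim_le R n ->
  forall j, (n <= j)%N -> exists (g : {linear P j.+1 -> P j.+2}) (h : {linear P j -> P j.+1}),
    forall x, x = res_d P j.+1 (g x) + h (res_d P j x).
Proof.
move=> /(_ M)[Q Q0] j nj.
have [u [u0 ud]] := resolution_lift P Q; have [v [v0 vd]] := resolution_lift Q P.
have [x|i x|h hP] := @resolution_homotopy R M P (fun j => idfun \- (v j \o u j)).
- by rewrite /= linearB /= v0 u0 subrr.
- by rewrite /= linearB /= vd ud.
exists (h j.+1), (h j) => x.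
by rewrite -hP /= [u j.+1 x]Q0 // linear0 subr0.
Qed.

(** * Graded free resolutions of the trivial module *)

Section ConnectedGraded.
Variables (k : fieldType) (A : cgAlg k).

Definition acomp (i : nat) (a : A) : A := component (cg_decomposition A) i a.

Lemma acomp_in i a : cg_comp i (acomp i a).
Proof. exact: component_in. Qed.

Lemma acomp_hom i j a : cg_comp j a -> acomp i a = if i == j then a else 0.
Proof. exact: component_hom. Qed.

Lemma acomp_id i a : cg_comp i a -> acomp i a = a.
Proof. exact: component_id. Qed.

Lemma acomp_bound a : exists M, a = \sum_(i < M) acomp i a.
Proof. exact: component_bound. Qed.

Lemma acomp_sum i I (s : seq I) (F : I -> A) :
  acomp i (\sum_(j <- s) F j) = \sum_(j <- s) acomp i (F j).
Proof. exact: component_sum. Qed.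

Lemma acomp0 i : acomp i 0 = 0.
Proof. exact: component0. Qed.

Lemma acompZ i c a : acomp i (c *: a) = c *: acomp i a.
Proof.
apply: (@eq_on_homogeneous _ _ _ _ (fun a => acomp i (c *: a))
  (fun a => c *: acomp i a) (cg_decomposition A)) => [x y|x y|j x jx].
- by rewrite scalerDr /acomp componentD.
- by rewrite /acomp componentD scalerDr.
- rewrite (acomp_hom i jx) (acomp_hom i (cg_compZ c jx)).
  by case: ifP; rewrite ?scaler0.
Qed.

Lemma acomp_linear i : linear (acomp i).
Proof. by move=> c a b; rewrite -acompZ /acomp componentD. Qed.

Lemma cg_aug_hom i a : cg_comp i a -> i != 0%N -> cg_aug A a = 0.
Proof. by case: i => // i /cg_aug_pos. Qed.

Lemma acomp0E a : acomp 0 a = (cg_aug A a)%:A.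
Proof.
apply: (@eq_on_homogeneous _ _ _ _ (acomp 0)
  (fun a => (cg_aug A a)%:A) (cg_decomposition A)) => [x y|x y|j x jx].
- by rewrite /acomp componentD.
- by rewrite rmorphD scalerDl.
rewrite (acomp_hom 0 jx); have [j0|j0] := eqVneq 0%N j; last first.
  by rewrite (cg_aug_hom jx) ?scale0r // eq_sym.
by move: jx; rewrite -j0 => /cg_connected[c ->]; rewrite cg_aug_scalar.
Qed.

Lemma scalar_hom (c : k) : cg_comp 0 (c%:A : A).
Proof. by apply/cg_connected; exists c. Qed.

(** Membership in the ideal of elements of degree at least [p]. The Nakayama arguments raise [p]
    indefinitely. *)
Definition vanishes_below (p : nat) (a : A) : Prop :=
  forall i, (i < p)%N -> acomp i a = 0.

Lemma vanishes_below1 a : cg_aug A a = 0 -> vanishes_below 1 a.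
Proof. by move=> a0 [|//] _; rewrite acomp0E a0 scale0r. Qed.

Lemma vanishes_belowM p q a b :
  vanishes_below p a -> vanishes_below q b -> vanishes_below (p + q) (a * b).
Proof.
move=> ap bq m mpq; have [M {1}->] := acomp_bound a; have [L {1}->] := acomp_bound b.
rewrite mulr_suml acomp_sum big1 // => i _.
rewrite mulr_sumr acomp_sum big1 // => j _.
have [ip|pi] := ltnP i p; first by rewrite ap // mul0r acomp0.
have [jq|qj] := ltnP j q; first by rewrite bq // mulr0 acomp0.
rewrite (acomp_hom m (cg_compM (acomp_in i a) (acomp_in j b))).
by rewrite ltn_eqF // (leq_trans mpq) // leq_add.
Qed.

Lemma vanishes_below_sum p I (s : seq I) (F : I -> A) :
  (forall i, vanishes_below p (F i)) -> vanishes_below p (\sum_(i <- s) F i).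
Proof. by move=> Fp i ip; rewrite acomp_sum big1 // => j _; apply: Fp. Qed.

Lemma vanishes_below_all a : (forall p, vanishes_below p a) -> a = 0.
Proof. by move=> ap; have [M ->] := acomp_bound a; rewrite big1 // => i _; apply: (ap i.+1). Qed.

End ConnectedGraded.

(** * Finite-dimensional subspaces of A-modules *)

Section FiniteBases.
Variables (k : fieldType) (A : cgAlg k).

(* k acts on an A-module through c |-> c%:A.                                    *)
Fixpoint kspan (V : lmodType A) (ts : seq V) (x : V) : Prop :=
  if ts is t :: ts' then exists c : k, kspan ts' (x - c%:A *: t) else x = 0.

Fixpoint kindep (V : lmodType A) (ts : seq V) : Prop :=
  if ts is t :: ts' then ~ kspan ts' t /\ kindep ts' else True.

Lemma kscalerA (V : lmodType A) (a b : k) (x : V) :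
  a%:A *: (b%:A *: x) = (a * b)%:A *: x.
Proof. by rewrite scalerA -scalerAl mul1r scalerA. Qed.

Lemma kscalerDl (V : lmodType A) (a b : k) (x : V) :
  (a + b)%:A *: x = a%:A *: x + b%:A *: x.
Proof. by rewrite scalerDl scalerDl. Qed.

Lemma kscalerN (V : lmodType A) (a : k) (x : V) : (- a)%:A *: x = - (a%:A *: x).
Proof. by rewrite !scaleNr. Qed.

Lemma kscale1r (V : lmodType A) (x : V) : (1 : k)%:A *: x = x.
Proof. by rewrite !scale1r. Qed.

Definition ksub (V : lmodType A) (S : V -> Prop) : Prop :=
  S 0 /\ forall (c : k) x y, S x -> S y -> S (c%:A *: x + y).

Lemma kspan_sub (V : lmodType A) (ts : seq V) : ksub (kspan ts).
Proof.
elim: ts => [|t ts [IH0 IH]]; first by split=> // c x y -> ->; rewrite scaler0 addr0.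
split=> [|c x y [a ax] [b bx]]; first by exists 0; rewrite !scale0r subr0.
exists (c * a + b); have := IH c _ _ ax bx; congr (kspan ts _).
by rewrite scalerBr addrACA -opprD kscalerDl kscalerA.
Qed.

Lemma ksubB (V : lmodType A) (S : V -> Prop) (c : k) x y : ksub S -> S x -> S y -> S (x - c%:A *: y).
Proof. by case=> _ SL Sx Sy; rewrite addrC -kscalerN; apply: SL.
Qed.

Lemma kspanP (V : lmodType A) (ts : seq V) x : kspan ts x <->
  exists c : 'I_(size ts) -> k, x = \sum_p (c p)%:A *: ts`_p.
Proof.
elim: ts x => [|t ts IH] x /=.
  split=> [->|[c ->]]; last by rewrite big_ord0.
  by exists (fun=> 0); rewrite big_ord0.
split=> [[c /IH[d e]]|[c ->]].
  exists (fun p => if unlift ord0 p is Some q then d q else c).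
  rewrite big_ord_recl unlift_none -[LHS](subrK (c%:A *: t)) addrC e /=; congr (_ + _).
  by apply: eq_bigr => q _; rewrite liftK.
exists (c ord0); apply/IH; exists (fun q => c (lift ord0 q)).
by rewrite big_ord_recl /= addrC addKr.
Qed.

Lemma kspan_subset (V : lmodType A) (S : V -> Prop) (ts : seq V) x :
  ksub S -> (forall t, t \in ts -> S t) -> kspan ts x -> S x.
Proof.
move=> Ssub; elim: ts x => [|t ts IH] x St /=; first by case: Ssub => S0 _ ->.
case=> c /IH H; rewrite -(subrK (c%:A *: t) x) addrC.
apply: Ssub.2; first by apply: St; rewrite inE eqxx.
by apply: H => u us; apply: St; rewrite inE us orbT.
Qed.

Lemma kspan_mem (V : lmodType A) (ts : seq V) t : t \in ts -> kspan ts t.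
Proof.
elim: ts => // u ts IH; rewrite inE => /orP[/eqP ->|/IH H] /=.
  by exists 1; rewrite kscale1r subrr; apply: (kspan_sub ts).1.
by exists 0; rewrite !scale0r subr0.
Qed.

Lemma kindepP (V : lmodType A) (ts : seq V) (c : 'I_(size ts) -> k) : kindep ts ->
  \sum_p (c p)%:A *: ts`_p = 0 -> forall p, c p = 0.
Proof.
elim: ts c => [|t ts IH] c /=; first by move=> _ _ [].
case=> tn ti; rewrite big_ord_recl /= => e.
have c0 : c ord0 = 0.
  apply: contrapT => /eqP c0; apply: tn; apply/kspanP.
  exists (fun q => - (c ord0)^-1 * c (lift ord0 q)).
  move/eqP: e; rewrite addrC addr_eq0 => /eqP e.
  have -> : t = (- (c ord0)^-1)%:A *: - ((c ord0)%:A *: t).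
    by rewrite scalerN kscalerN opprK kscalerA mulVf // kscale1r.
  rewrite -e scaler_sumr; apply: eq_bigr => q _.
  exact: kscalerA.
move: e; rewrite c0 !scale0r add0r => /(IH (fun q => c (lift ord0 q)) ti) H p.
by case: (unliftP ord0 p) => [q ->|->].
Qed.

(** Induction on [ts]: the elements of S whose image avoids [t] form a subspace of codimension at
    most one. If it is proper, one vector [x0] outside it completes a basis. *)
Lemma finite_basis (V V' : lmodType A) (g : {linear V -> V'}) (ts : seq V')
    (S : V -> Prop) : ksub S -> (forall x, S x -> kspan ts (g x)) ->
  (forall x, S x -> g x = 0 -> x = 0) ->
  exists ws : seq V,
    [/\ forall w, w \in ws -> S w, forall x, S x -> kspan ws x & kindep ws].
Proof.
elim: ts S => [|t ts IH] S Ssub Sg gi.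
  by exists [::]; split=> // x Sx; apply: gi => //; apply: Sg.
have [H|] := pselect (forall x, S x -> kspan ts (g x)); first exact: IH.
move=> /existsNP[x0 /not_implyP[Sx0 nx0]].
have [|||ws [wS wsp wi]] := IH (fun x => S x /\ kspan ts (g x)).
- have [S0 SL] := Ssub; have [K0 KL] := kspan_sub ts.
  split=> [|c x y [Sx Kx] [Sy Ky]]; first by rewrite linear0.
  by split; [apply: SL|rewrite linearP; apply: KL].
- by move=> x [].
- by move=> x [Sx _]; apply: gi.
have [c0 kc0] := Sg x0 Sx0.
have c0n : c0 != 0 by apply/eqP => c00; apply: nx0; move: kc0; rewrite c00 !scale0r subr0.
exists (x0 :: ws); split=> [w|x Sx|].
- by rewrite inE => /orP[/eqP -> //|/wS[]].
(* This multiple of [x0] cancels the coefficient of [t] in [g x]. *)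
- have [c kc] := Sg x Sx; exists (c / c0); apply: wsp; split; first exact: ksubB.
  have := ksubB (c / c0) (kspan_sub ts) kc kc0; congr (kspan ts _).
  by rewrite linearB [g (_ *: _)]linearZ_LR scalerBr kscalerA divfK // opprB addrA subrK.
split=> // /(kspan_subset (S := fun x => S x /\ kspan ts (g x))) [||//].
  have [S0 SL] := Ssub; have [K0 KL] := kspan_sub ts.
  split=> [|c x y [Sx Kx] [Sy Ky]]; first by rewrite linear0.
  by split; [apply: SL|rewrite linearP; apply: KL].
exact: wS.
Qed.

Definition kbasis (V : lmodType A) (S : V -> Prop) r (w : 'I_r -> V) : Prop :=
  [/\ forall p, S (w p),
      forall x, S x -> exists c : 'I_r -> k, x = \sum_p (c p)%:A *: w p
    & forall c : 'I_r -> k, \sum_p (c p)%:A *: w p = 0 -> forall p, c p = 0].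

Lemma finite_kbasis (V V' : lmodType A) (g : {linear V -> V'}) (ts : seq V')
    (S : V -> Prop) : ksub S -> (forall x, S x -> kspan ts (g x)) ->
  (forall x, S x -> g x = 0 -> x = 0) ->
  exists r (w : 'I_r -> V), kbasis S w.
Proof.
move=> Ssub Sg gi; have [ws [wS wsp wi]] := finite_basis Ssub Sg gi.
exists (size ws), (fun p => ws`_p); split=> [p|x /wsp /kspanP //|c /(kindepP wi) //].
by apply/wS/mem_nth.
Qed.

(** Words in the degree-one generators span A, only words of length [e] contribute in degree [e],
    and there are finitely many of these. *)
Lemma graded_part_kspan N : presented_in_degree A N ->
  forall e, exists us : seq (A^o), forall a : A, cg_comp e a -> kspan us a.
Proof.
move=> [r [x [R [x1 _ gen _ _]]]] e.
pose word (u : seq 'I_r) : A := \prod_(i <- u) x i.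
have word_hom u : cg_comp (size u) (word u).
  rewrite /word; elim: u => [|i u IH]; first by rewrite big_nil -[1]scale1r; apply: scalar_hom.
  by rewrite big_cons; apply: (cg_compM (x1 i) IH).
exists [seq word u | u : e.-tuple 'I_r] => a ae.
have [s as_] := gen a; rewrite -(acomp_id ae) as_ acomp_sum {ae as_}.
set us := (X in kspan X _); have [K0 KL] := kspan_sub (us : seq A^o).
elim: s => [|u s IH]; first by rewrite big_nil.
rewrite big_cons acompZ -mulr_algl; apply: KL => //.
rewrite -/(word u.2) (acomp_hom _ (word_hom u.2)); case: eqP => [eu|//].
apply: kspan_mem; apply/fintype.imageP; exists (tcast (esym eu) (in_tuple u.2)) => //.
by rewrite val_tcast.
Qed.

End FiniteBases.

(** * Graded projective modules generated in one degree *)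

Section GradedFreeModule.
Variables (k : fieldType) (A : cgAlg k) (Q : lmodType A) (G : int -> Q -> Prop).
Variables (z : nat) (r : nat) (w : 'I_r -> Q).
Hypotheses (gG : module_grading G) (gen : generated_in_degree G z%:Z).

Definition qcomp (m : int) (x : Q) : Q := component gG.1 m x.

Lemma qcomp_sum m I (s : seq I) (F : I -> Q) :
  qcomp m (\sum_(j <- s) F j) = \sum_(j <- s) qcomp m (F j).
Proof. exact: component_sum. Qed.

Lemma qcomp_id m x : G m x -> qcomp m x = x.
Proof. exact: component_id. Qed.

Lemma qcomp_gen j (a : A) x : G z%:Z x -> qcomp (j%:Z + z%:Z) (a *: x) = acomp j a *: x.
Proof.
move=> Gx; apply: (@eq_on_homogeneous _ _ _ _ (fun a => qcomp (j%:Z + z%:Z) (a *: x))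
  (fun a => acomp j a *: x) (cg_decomposition A)) => [b c|b c|i b bi].
- by rewrite scalerDl /qcomp componentD.
- by rewrite (linD (acomp_linear _)) scalerDl.
rewrite (acomp_hom _ bi) /qcomp (component_hom _ _ (gG.2 _ _ _ _ bi Gx)).
rewrite (inj_eq (addIr _)) eqz_nat; case: eqP => // _.
by rewrite scale0r.
Qed.

Lemma qcomp_gen_lt m (a : A) x : G z%:Z x -> (m < z%:Z)%R -> qcomp m (a *: x) = 0.
Proof.
move=> Gx mz; apply: (@eq_on_homogeneous _ _ _ _ (fun a => qcomp m (a *: x))
  (fun a => 0) (cg_decomposition A)) => [b c|b c|i b bi].
- by rewrite scalerDl /qcomp componentD.
- by rewrite addr0.
rewrite /qcomp (component_hom _ _ (gG.2 _ _ _ _ bi Gx)); case: eqP => // mi.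
by move: mz; rewrite mi Order.TotalTheory.ltNge Num.Theory.lerDr.
Qed.

Lemma below_generators m x : G m x -> (m < z%:Z)%R -> x = 0.
Proof.
move=> Gx mz; rewrite -(qcomp_id Gx); have [s [sG ->]] := gen x.
rewrite qcomp_sum big_seq big1 // => u us.
by rewrite qcomp_gen_lt //; apply: sG.
Qed.

Hypothesis wb : kbasis (G z%:Z) w.

Lemma generator_hom p : G z%:Z (w p). Proof. by case: wb. Qed.

Lemma basis_generates x : exists a : 'I_r -> A, x = \sum_p a p *: w p.
Proof.
case: wb => _ wspan _; have [s [sG ->]] := gen x.
elim: s sG => [|u s IH] sG.
  by exists (fun=> 0); rewrite big_nil big1 // => p _; rewrite scale0r.
have [|a ea] := IH; first by move=> v vs; apply: sG; rewrite inE vs orbT.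
have [|c ec] := wspan u.2; first by apply: sG; rewrite inE eqxx.
exists (fun p => u.1 * (c p)%:A + a p); rewrite big_cons ea ec scaler_sumr -big_split.
by apply: eq_bigr => p _; rewrite scalerDl scalerA.
Qed.

Lemma qcomp_basis j (a : 'I_r -> A) :
  qcomp (j%:Z + z%:Z) (\sum_p a p *: w p) = \sum_p acomp j (a p) *: w p.
Proof. by rewrite qcomp_sum; apply: eq_bigr => p _; apply/qcomp_gen/generator_hom. Qed.

(** In the generating degree a relation involves only the scalar parts of its coefficients, and [w]
    is independent over k. *)
Lemma relation_aug (a : 'I_r -> A) :
  \sum_p a p *: w p = 0 -> forall p, cg_aug A (a p) = 0.
Proof.
move=> a0; case: wb => _ _ wi; apply: wi.
transitivity (qcomp (0%N%:Z + z%:Z) (\sum_p a p *: w p)); last by rewrite a0 /qcomp component0.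
by rewrite qcomp_basis; apply: eq_bigr => p _; rewrite acomp0E.
Qed.

Definition combination (v : {ffun 'I_r -> A^o}) : Q := \sum_p v p *: w p.

Fact combination_linear : linear combination.
Proof.
move=> a u v; rewrite /combination scaler_sumr -big_split; apply: eq_bigr => p _.
by rewrite !ffunE scalerDl -scalerA.
Qed.
HB.instance Definition _ :=
  GRing.isLinear.Build A {ffun 'I_r -> A^o} Q _ combination combination_linear.

(* A splitting [s] of [combination] shows that its kernel K satisfies         *)
(* K = A_+ K, which forces K = 0.                                             *)
Lemma basis_free (a : 'I_r -> A) : projective Q ->
  \sum_p a p *: w p = 0 -> forall p, a p = 0.
Proof.
move=> projQ.
have [x|s sK] := projQ _ _ combination idfun.
  have [b ->] := basis_generates x; exists [ffun p => b p].
  by rewrite /combination; apply: eq_bigr => p _; rewrite ffunE.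
pose e p : {ffun 'I_r -> A^o} := [ffun q => (p == q)%:R].
pose kap p := e p - s (combination (e p)).
have kapK p : combination (kap p) = 0 by rewrite /kap linearB /= sK subrr.
have expand (v : {ffun 'I_r -> A^o}) : v = \sum_p v p *: e p.
  apply/ffunP => q; rewrite sum_ffunE (bigD1 q) //= big1 => [|p pq].
    by rewrite !ffunE eqxx addr0 /= [_ *: _]mulr1.
  by rewrite !ffunE (negPf pq) [_ *: _]mulr0.
(* The projector onto K fixes [v]; applied to its coordinates it expresses [v] through the elements
   [kap p] of K, with the same coefficients, which lie in A_+ by [relation_aug]. *)
have kexp v : combination v = 0 -> v = \sum_p v p *: kap p.
  move=> v0; transitivity (v - s (combination v)); first by rewrite v0 linear0 subr0.
  rewrite {1 2}[v]expand (linear_sum combination) (linear_sum s) -sumrB.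
  by apply: eq_bigr => p _; rewrite linearZ_LR linearZ_LR -scalerBr.
have key n v : combination v = 0 -> forall p, vanishes_below n (v p).
  elim: n v => [//|n IH] v v0 p; rewrite (kexp v v0) sum_ffunE.
  apply: vanishes_below_sum => q; rewrite ffunE -add1n.
  apply: vanishes_belowM; last exact: IH.
  by apply/vanishes_below1/(relation_aug v0).
move=> a0 p; apply: vanishes_below_all => n.
have := @key n [ffun p => a p] _ p; rewrite ffunE; apply.
by rewrite -[RHS]a0; apply: eq_bigr => q _; rewrite ffunE.
Qed.

Lemma coefficient_hom j (a : 'I_r -> A) : projective Q ->
  G (j%:Z + z%:Z) (\sum_p a p *: w p) -> forall p, cg_comp j (a p).
Proof.
move=> projQ Ga p.
have : a p - acomp j (a p) = 0.
  apply: (@basis_free (fun p => a p - acomp j (a p)) projQ).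
  rewrite (eq_bigr (fun p => a p *: w p - acomp j (a p) *: w p)); last first.
    by move=> q _; rewrite scalerBl.
  by rewrite sumrB -qcomp_basis (qcomp_id Ga) subrr.
by move/eqP; rewrite subr_eq0 => /eqP ->; apply: acomp_in.
Qed.

(** Rewriting an element through Q = A_+ Q and comparing unique coefficients shows that every
    coefficient lies in arbitrarily high degree. A basis vector would have coefficient 1, so there
    is none. *)
Lemma nakayama_rank0 : projective Q ->
  (forall x : Q, exists s : seq (A * Q),
     (forall u, u \in s -> cg_aug A u.1 = 0) /\ x = \sum_(u <- s) u.1 *: u.2) ->
  r = 0%N.
Proof.
move=> projQ QA.
have key n (a : 'I_r -> A) p : vanishes_below n (a p).
  elim: n a p => [//|n IH] a p.
  have [s [s0 es]] := QA (\sum_p a p *: w p).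
  have /choice[b bP] : forall u : A * Q, exists b : 'I_r -> A, u.2 = \sum_p b p *: w p.
    by move=> u; apply: basis_generates.
  have : a p - \sum_(u <- s) u.1 * b u p = 0.
    apply: (@basis_free (fun p => a p - \sum_(u <- s) u.1 * b u p) projQ).
    rewrite (eq_bigr (fun p => a p *: w p - \sum_(u <- s) u.1 *: (b u p *: w p))); last first.
      move=> q _; rewrite scalerBl scaler_suml; congr (_ - _).
      by apply: eq_bigr => u _; rewrite scalerA.
    rewrite sumrB es exchange_big /=; apply/eqP; rewrite subr_eq0; apply/eqP.
    by apply: eq_bigr => u _; rewrite {1}bP scaler_sumr.
  move/eqP; rewrite subr_eq0 => /eqP -> i ip; rewrite acomp_sum big_seq big1 // => u us.
  by rewrite (vanishes_belowM (vanishes_below1 (s0 u us)) (IH (b u) p)).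
case: (posnP r) => // r0.
have := @vanishes_below_all k A 1 (fun n => key n (fun=> 1) (Ordinal r0)).
by move/eqP; rewrite oner_eq0.
Qed.

End GradedFreeModule.

(** * The Koszul resolution in coordinates *)

Section FreeResolution.
Variables (k : fieldType) (A : cgAlg k).

Definition rowmul m r (D : 'I_m -> 'I_r -> A) (v : {ffun 'I_m -> A}) :
  {ffun 'I_r -> A} := [ffun q => \sum_p v p * D p q].

(** A free resolution of [trivial A] by left modules of row vectors. Step 0 has rank one, expressed
    by a unique index [fr_top] to avoid transports. All entries of one matrix share a degree, so its
    lift to bimodules is homogeneous. *)
Record free_resolution := FreeResolution {
  fr_rank : nat -> nat;
  fr_mx : forall i, 'I_(fr_rank i.+1) -> 'I_(fr_rank i) -> A;
  fr_deg : nat -> nat;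
  fr_hom : forall i p q, cg_comp (fr_deg i) (fr_mx (i := i) p q);
  fr_top : 'I_(fr_rank 0);
  fr_topE : forall p, p = fr_top;
  fr_exact0 : forall v : {ffun 'I_(fr_rank 0) -> A},
    cg_aug A (v fr_top) = 0 <-> exists y, rowmul (@fr_mx 0) y = v;
  fr_exact : forall i (v : {ffun 'I_(fr_rank i.+1) -> A}),
    rowmul (@fr_mx i) v = 0 <-> exists y, rowmul (@fr_mx i.+1) y = v
}.

Lemma jump_lt N i : (1 < N)%N -> (jump N i < jump N i.+1)%N.
Proof.
move=> N1; rewrite /jump /= uphalf_half; case: (odd i) => /=.
  by rewrite addn0 mulnDr muln1 addnC ltn_add2r.
by rewrite addn0 add0n addn1.
Qed.

Lemma ksub_sum (V : lmodType A) (S : V -> Prop) I (s : seq I) (F : I -> V) :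
  ksub S -> (forall i, S (F i)) -> S (\sum_(i <- s) F i).
Proof.
move=> [S0 SL] SF; apply: big_ind => // x y Sx Sy.
by rewrite -[x]kscale1r; apply: SL.
Qed.

Section Koszul.
Variables (N n : nat).
Hypotheses (N1 : (1 < N)%N) (presA : presented_in_degree A N).
Variables (P : resolution (trivial A)) (G : forall i, int -> P i -> Prop).
Arguments G : clear implicits.
Hypotheses (gP : graded_resolution G) (minP : minimal_resolution P).
Hypothesis gen : forall i, generated_in_degree (G i) (jump N i)%:Z.

Let gG i : module_grading (G i). Proof. by case: gP. Qed.

Lemma ksub_graded i m : ksub (G i m).
Proof.
case: (gG i) => -[G0 GB _ _] GA.
have GZ (c : k) x : G i m x -> G i m (c%:A *: x).
  by rewrite -{2}[m]add0r; apply: GA; apply: scalar_hom.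
split=> // c x y Gx Gy; rewrite -[y]opprK; apply: (GB); first exact: GZ.
by rewrite -sub0r; apply: GB.
Qed.

Lemma qcomp_d i m (x : P i.+1) : qcomp (gG i) m (res_d P i x) = res_d P i (qcomp (gG i.+1) m x).
Proof.
apply: (@eq_on_homogeneous _ _ _ _ (fun x => qcomp (gG i) m (res_d P i x))
  (fun x => res_d P i (qcomp (gG i.+1) m x)) (gG i.+1).1) => [y z|y z|j y Gy].
- by rewrite linearD /qcomp componentD.
- by rewrite /qcomp componentD linearD.
have Gd : G i j (res_d P i y) by case: gP => _ + _; apply.
rewrite /qcomp (component_hom _ _ Gy) (component_hom _ _ Gd).
by case: eqP; rewrite ?linear0.
Qed.

(* P_{i+1} starts in degree jump N i.+1 > jump N i.                             *)
Lemma boundary_eq0 i (x : P i.+1) : G i (jump N i)%:Z (res_d P i x) -> res_d P i x = 0.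
Proof.
move=> Gd; rewrite -(qcomp_id (gG i) Gd) qcomp_d.
have -> : qcomp (gG i.+1) (jump N i)%:Z x = 0; last by rewrite linear0.
apply: (below_generators (gG i.+1) (@gen i.+1) (component_in _ _ _)).
by rewrite ltz_nat jump_lt.
Qed.

Lemma top_generator : exists2 w0 : P 0%N, G 0%N 0 w0 & res_aug P w0 = (1 : k).
Proof.
have [y y1] := res_surj P (1 : k).
exists (qcomp (gG 0%N) 0 y); first exact: component_in.
rewrite -y1; apply: (@eq_on_homogeneous _ _ _ _ (fun x => res_aug P (qcomp (gG 0%N) 0 x))
  (res_aug P) (gG 0%N).1) => [x z|x z|j x Gx].
- by rewrite /qcomp componentD linearD.
- by rewrite linearD.
rewrite /qcomp (component_hom _ _ Gx); case: eqP => // j0.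
by case: gP => _ _ /(_ _ _ Gx) ->; rewrite ?linear0 //; apply/eqP => j0'; apply: j0.
Qed.

(** The kernel of the augmentation consists of boundaries, and [boundary_eq0] kills those of degree
    0, so one vector spans that degree. *)
Lemma koszul_kbasis0 : exists w : 'I_1 -> P 0%N, kbasis (G 0%N (jump N 0)%:Z) w.
Proof.
have [w0 Gw0 w1] := top_generator.
have augZ (c : k) x : res_aug P (c%:A *: x) = c * (res_aug P x : k) :> k.
  by rewrite linearZ_LR /= /GRing.scale /= /triv_scale cg_aug_scalar.
rewrite /jump muln0; exists (fun=> w0); split=> // [x Gx|c].
  exists (fun=> res_aug P x : k); rewrite big_ord1.
  apply/eqP; rewrite -subr_eq0; apply/eqP.
  have [y dy] : exists y, res_d P 0 y = x - (res_aug P x : k)%:A *: w0.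
    by apply/res_exact0; rewrite linearB augZ w1 mulr1 subrr.
  rewrite -dy; apply: boundary_eq0; rewrite dy /jump muln0.
  by apply: ksubB => //; apply: ksub_graded.
rewrite big_ord1 => e p; have := augZ (c ord0) w0.
by rewrite (ord1 p) e linear0 w1 mulr1.
Qed.

(* d is injective on the generators of P_{i+1}, and their images have           *)
(* coefficients in the finite dimensional component of A of degree e.           *)
Lemma koszul_kbasis i : exists r (w : 'I_r -> P i),
  kbasis (G i (jump N i)%:Z) w /\ (i = 0%N -> r = 1%N).
Proof.
elim: i => [|i [r [w [wb _]]]].
  by have [w wb] := koszul_kbasis0; exists 1%N, w.
pose e := (jump N i.+1 - jump N i)%N.
have ee : (jump N i.+1)%:Z = e%:Z + (jump N i)%:Z.
  by rewrite -PoszD subnK // ltnW // jump_lt.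
have [us usP] := graded_part_kspan presA e.
pose ts : seq (P i) := [seq (u : A) *: w p | u <- us, p <- enum 'I_r].
have [x Gx|x Gx dx|s [v vb]] := finite_kbasis (g := res_d P i) (ts := ts) (ksub_graded i.+1 (jump N i.+1)%:Z).
- have Gd : G i (jump N i.+1)%:Z (res_d P i x) by case: gP => _ + _; apply.
  have [a ea] := basis_generates (@gen i) wb (res_d P i x).
  rewrite ee ea in Gd; rewrite ea; apply: ksub_sum => [|p]; first exact: kspan_sub.
  apply: (kspan_subset (S := fun b : A^o => kspan ts ((b : A) *: w p)) _ _ (usP _ _)).
  + have [K0 KL] := kspan_sub ts; split; first by rewrite scale0r.
    by move=> c b b' Kb Kb'; rewrite scalerDl -scalerA; apply: KL.
  + by move=> u uus; apply/kspan_mem/allpairs_f; rewrite ?mem_enum.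
  + exact: (coefficient_hom (gG i) (@gen i) wb (@res_projective _ _ P i) Gd).
- have [y dy] : exists y, res_d P i.+1 y = x by apply/res_exact.
  by rewrite -dy; apply: boundary_eq0; rewrite dy.
- by exists s, v.
Qed.

Lemma koszul_free_resolution : gldim_le A n ->
  exists F : free_resolution, forall i, (n < i)%N -> fr_rank F i = 0%N.
Proof.
move=> gld.
have rwP i : {rw : {r : nat & 'I_r -> P i} |
    kbasis (G i (jump N i)%:Z) (tagged rw) /\ (i = 0%N -> tag rw = 1%N)}.
  by apply: cid; have [r [w wP]] := koszul_kbasis i; exists (Tagged (fun r => 'I_r -> P i) w).
pose r i := tag (sval (rwP i)); pose w i : 'I_(r i) -> P i := tagged (sval (rwP i)).
have wb i : kbasis (G i (jump N i)%:Z) (w i) by case: (svalP (rwP i)).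
have r0 : r 0%N = 1%N by case: (svalP (rwP 0%N)) => _; apply.
move: r w wb r0 => {rwP} r w wb r0.
pose e i := (jump N i.+1 - jump N i)%N.
have ee i : (jump N i.+1)%:Z = (e i)%:Z + (jump N i)%:Z.
  by rewrite -PoszD subnK // ltnW // jump_lt.
have projP i : projective (P i) := @res_projective _ _ P i.
have DE i : {D : 'I_(r i.+1) -> 'I_(r i) -> A |
    forall p, res_d P i (w i.+1 p) = \sum_q D p q *: w i q}.
  have [f fP] := choice (fun p => basis_generates (@gen i) (wb i) (res_d P i (w i.+1 p))).
  by exists f.
pose D i := sval (DE i).
have DP i p : res_d P i (w i.+1 p) = \sum_q D i p q *: w i q := svalP (DE i) p.
have Dhom i p q : cg_comp (e i) (D i p q).
  apply: (coefficient_hom (gG i) (@gen i) (wb i) (projP i)).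
  by rewrite -ee -DP; case: gP => _ + _; apply; apply: generator_hom (wb i.+1) p.
pose al i (v : {ffun 'I_(r i) -> A}) : P i := \sum_p v p *: w i p.
have al_inj i u v : al i u = al i v -> u = v.
  move=> euv; apply/ffunP => p; apply/eqP; rewrite -subr_eq0; apply/eqP.
  apply: (basis_free (gG i) (@gen i) (wb i) (a := fun p => u p - v p) (projP i)).
  rewrite (eq_bigr (fun p => u p *: w i p - v p *: w i p)) => [|q _]; last exact: scalerBl.
  by rewrite sumrB; apply/eqP; rewrite subr_eq0; apply/eqP.
have al_surj i x : exists v, al i v = x.
  have [a ->] := basis_generates (@gen i) (wb i) x; exists [ffun p => a p].
  by apply: eq_bigr => p _; rewrite ffunE.
have al0 i : al i 0 = 0 by rewrite /al big1 // => p _; rewrite ffunE scale0r.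
have al_d i v : res_d P i (al i.+1 v) = al i (rowmul (D i) v).
  rewrite linear_sum /=; transitivity (\sum_p \sum_q (v p * D i p q) *: w i q).
    apply: eq_bigr => p _; rewrite linearZ_LR DP scaler_sumr.
    by apply: eq_bigr => q _; rewrite scalerA.
  rewrite exchange_big; apply: eq_bigr => q _.
  by rewrite ffunE scaler_suml.
have [top topE] : exists t : 'I_(r 0%N), forall p, p = t.
  by move: (r 0%N) r0 => _ ->; exists ord0 => p; apply: ord1.
have ex0 (v : {ffun 'I_(r 0%N) -> A}) : cg_aug A (v top) = 0 <-> exists y, rowmul (D 0%N) y = v.
  have e0 : res_aug P (al 0%N v) = cg_aug A (v top) * (res_aug P (w 0%N top) : k) :> k.
    rewrite /al (bigD1 top) //= big1 => [|p]; last by rewrite (topE p) eqxx.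
    by rewrite addr0 linearZ_LR.
  have w0 : (res_aug P (w 0%N top) : k) != 0.
    apply/eqP => w0; have [y y1] := res_surj P (1 : k).
    have [u eu] := al_surj 0%N y; have := oner_neq0 k; rewrite -[1]y1 -eu.
    rewrite /al linear_sum big1 ?eqxx // => p _.
    rewrite linearZ_LR (topE p); have -> : res_aug P (w 0%N top) = 0 by [].
    by rewrite /= scaler0.
  split=> [v0|[y ey]].
    have [y] : exists y, res_d P 0 y = al 0%N v.
      by apply/res_exact0; rewrite [LHS]e0 v0 mul0r.
    have [u <-] := al_surj 1%N y; rewrite al_d => /al_inj eu.
    by exists u.
  have /eqP : res_aug P (al 0%N v) = 0 by apply/res_exact0; rewrite -ey -al_d; eexists.
  by rewrite [X in X == _]e0 mulf_eq0 (negPf w0) orbF => /eqP.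
have ex i (v : {ffun 'I_(r i.+1) -> A}) : rowmul (D i) v = 0 <-> exists y, rowmul (D i.+1) y = v.
  split=> [v0|[y ey]].
    have [y] : exists y, res_d P i.+1 y = al i.+1 v.
      by apply/res_exact; rewrite al_d v0 al0.
    have [u <-] := al_surj i.+2 y; rewrite al_d => /al_inj eu.
    by exists u.
  apply: al_inj; rewrite al0 -al_d; apply/res_exact; rewrite -ey -al_d; by eexists.
exists (FreeResolution Dhom topE ex0 ex); case=> [//|i] ni.
(* In [x = d (g x) + h (d x)] minimality puts both terms in A_+ [P i.+1], the second because [h] is
   linear. *)
apply: (nakayama_rank0 (gG i.+1) (@gen i.+1) (wb i.+1) (projP i.+1)) => x.
have [g [h xE]] := resolution_beyond_gldim P gld ni.
have [s [s0 es]] := minP (g x); have [t [t0 et]] := minP x.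
exists (s ++ [seq (u.1, h u.2) | u <- t]); split=> [u|].
  by rewrite mem_cat => /orP[/s0 //|/mapP[v /t0 v0 ->]].
rewrite [LHS]xE big_cat big_map /= es et linear_sum; congr (_ + _).
by apply: eq_bigr => u _; rewrite linearZ_LR.
Qed.

End Koszul.
End FreeResolution.

(** * Free bimodules *)

Section TensorExtensionality.
Variables (k : fieldType) (V W : lmodType k).

Lemma tens_ind (C : tens V W -> Prop) :
  C 0 -> (forall x y, C x -> C y -> C (x + y)) -> (forall v w, C (pure v w)) ->
  forall t, C t.
Proof. by move=> C0 CD Cp t; have [s ->] := tens_sum_pure t; apply: big_ind. Qed.

Lemma tens_ext (U : lmodType k) (f g : tens V W -> U) :
  linear f -> linear g -> (forall v w, f (pure v w) = g (pure v w)) -> f =1 g.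
Proof.
move=> fL gL fg; apply: tens_ind => [|x y fx fy|v w]; last exact: fg.
  by rewrite !lin0.
by rewrite (linD fL) (linD gL) fx fy.
Qed.

Lemma pure_linear1 w : linear ((@pure k V W)^~ w).
Proof. by case: (pure_bilinear V W) => H _; apply: H. Qed.

Lemma pure_linear2 v : linear (@pure k V W v).
Proof. by case: (pure_bilinear V W) => _ H; apply: H. Qed.

End TensorExtensionality.

Lemma lin_add (R : comPzRingType) (U V : lmodType R) (f g : U -> V) :
  linear f -> linear g -> linear (fun x => f x + g x).
Proof. by move=> fL gL c x y; rewrite fL gL scalerDr addrACA. Qed.

Lemma lin_scale (R : comPzRingType) (U V : lmodType R) (c : R) (f : U -> V) :
  linear f -> linear (fun x => c *: f x).
Proof. by move=> fL d x y; rewrite fL scalerDr !scalerA mulrC. Qed.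

Lemma lin_bigsum (R : comPzRingType) (U V : lmodType R) I (s : seq I)
    (f : I -> U -> V) :
  (forall i, linear (f i)) -> linear (fun x => \sum_(i <- s) f i x).
Proof.
move=> fL c x y; rewrite scaler_sumr -big_split; apply: eq_bigr => i _.
exact: fL.
Qed.

Section FreeBimodule.
Variables (k : fieldType) (A : algType k) (r : nat).
Local Notation F := {ffun 'I_r -> A}.

Definition lmul (a : A) (v : F) : F := [ffun p => a * v p].

Lemma lmul_linear1 v : linear (lmul^~ v).
Proof. by move=> c a b; apply/ffunP => p; rewrite !ffunE mulrDl scalerAl. Qed.

Lemma lmul_linear2 a : linear (lmul a).
Proof. by move=> c u v; apply/ffunP => p; rewrite !ffunE mulrDr scalerAr. Qed.

Definition free_lact (a : A) : tens F A -> tens F A :=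
  tens_lift (fun v b => pure (lmul a v) b).
Definition free_ract (t : tens F A) (c : A) : tens F A :=
  tens_lift (fun v b => pure v (b * c)) t.

Fact free_lact_bilinear a : bilinear_map (fun (v : F) (b : A) => pure (lmul a v) b).
Proof.
split=> [b|v]; last exact: pure_linear2.
exact: (lin_comp (pure_linear1 b) (lmul_linear2 a)).
Qed.

Fact free_ract_bilinear c : bilinear_map (fun (v : F) (b : A) => pure v (b * c)).
Proof.
split=> [b|v]; first exact: pure_linear1.
exact: (lin_comp (pure_linear2 v) (mulr_linear' c)).
Qed.

Lemma free_lact_pure a v b : free_lact a (pure v b) = pure (lmul a v) b.
Proof. exact: tens_lift_pure (free_lact_bilinear a). Qed.

Lemma free_ract_pure v b c : free_ract (pure v b) c = pure v (b * c).
Proof. exact: tens_lift_pure (free_ract_bilinear c). Qed.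

Fact free_lact_linear2 a : linear (free_lact a).
Proof. exact/tens_lift_linear/free_lact_bilinear. Qed.

Fact free_ract_linear1 c : linear (free_ract^~ c).
Proof. exact/tens_lift_linear/free_ract_bilinear. Qed.

Fact free_lact_linear1 t : linear (free_lact^~ t).
Proof.
move=> c a b; move: t; apply: (tens_ext (g := fun t => c *: free_lact a t + free_lact b t)).
- exact: free_lact_linear2.
- by apply: lin_add; [apply: lin_scale|]; apply: free_lact_linear2.
by move=> v w; rewrite !free_lact_pure lmul_linear1 pure_linear1.
Qed.

Fact free_ract_linear2 t : linear (free_ract t).
Proof.
move=> c a b; move: t.
apply: (tens_ext (f := free_ract^~ _) (g := fun t => c *: free_ract t a + free_ract t b)).
- exact: free_ract_linear1.
- by apply: lin_add; [apply: lin_scale|]; apply: free_ract_linear1.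
by move=> v w; rewrite !free_ract_pure mulrDr -scalerAr pure_linear2.
Qed.

Fact free_lact1 t : free_lact 1 t = t.
Proof.
move: t; apply: (tens_ext (g := id)) => // [|v w]; first exact: free_lact_linear2.
by rewrite free_lact_pure; congr pure; apply/ffunP => p; rewrite ffunE mul1r.
Qed.

Fact free_lactM a b t : free_lact (a * b) t = free_lact a (free_lact b t).
Proof.
move: t; apply: (tens_ext (g := fun t => free_lact a (free_lact b t))).
- exact: free_lact_linear2.
- by apply: lin_comp; apply: free_lact_linear2.
by move=> v w; rewrite !free_lact_pure; congr pure; apply/ffunP => p; rewrite !ffunE mulrA.
Qed.

Fact free_ract1 t : free_ract t 1 = t.
Proof.
move: t; apply: (tens_ext (f := free_ract^~ 1) (g := id)) => // [|v w].
  exact: free_ract_linear1.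
by rewrite free_ract_pure mulr1.
Qed.

Fact free_ractM a b t : free_ract t (a * b) = free_ract (free_ract t a) b.
Proof.
move: t; apply: (tens_ext (f := free_ract^~ _) (g := fun t => free_ract (free_ract t a) b)).
- exact: free_ract_linear1.
- by apply: (lin_comp (f := free_ract^~ b)); apply: free_ract_linear1.
by move=> v w; rewrite !free_ract_pure mulrA.
Qed.

Fact free_lact_ract a b t : free_lact a (free_ract t b) = free_ract (free_lact a t) b.
Proof.
move: t; apply: (tens_ext (f := fun t => free_lact a (free_ract t b))
  (g := fun t => free_ract (free_lact a t) b)).
- by apply: lin_comp; [apply: free_lact_linear2|apply: free_ract_linear1].
- by apply: (lin_comp (f := free_ract^~ b));
    [apply: free_ract_linear1|apply: free_lact_linear2].
by move=> v w; rewrite free_ract_pure !free_lact_pure free_ract_pure.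
Qed.

(** Encoded as A^r (x) A so that - (x)_A k leaves A^r, the row vectors of [free_resolution]. *)
Definition free_bimodule : bimodule A :=
  @Bimodule k A (tens F A) free_lact free_ract
    free_lact_linear1 free_lact_linear2 free_ract_linear1 free_ract_linear2
    free_lact1 free_lactM free_ract1 free_ractM free_lact_ract.

Definition single (p : 'I_r) (a : A) : F := [ffun q => if q == p then a else 0].

Lemma single_linear p : linear (single p).
Proof. by move=> c a b; apply/ffunP => q; rewrite !ffunE; case: ifP; rewrite ?scaler0 ?addr0. Qed.

Lemma lmul_single a p b : lmul a (single p b) = single p (a * b).
Proof. by apply/ffunP => q; rewrite !ffunE; case: ifP; rewrite ?mulr0. Qed.

Lemma single_sum (v : F) : v = \sum_p single p (v p).
Proof.
apply/ffunP => q; rewrite sum_ffunE (bigD1 q) //= big1 ?addr0 => [|p pq].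
  by rewrite ffunE eqxx.
by rewrite ffunE eq_sym (negPf pq).
Qed.

Definition generator p : free_bimodule := pure (single p 1) 1.

Lemma pure_generators v b :
  pure v b = \sum_p ract (lact (v p) (generator p)) b :> free_bimodule.
Proof.
rewrite {1}[v]single_sum (lin_sum (pure_linear1 b)); apply: eq_bigr => p _.
by rewrite /= free_lact_pure free_ract_pure lmul_single mulr1 mul1r.
Qed.

Section Lift.
Variables (M : bimodule A) (m : 'I_r -> M).

Definition free_lift : free_bimodule -> M :=
  tens_lift (fun (v : F) (b : A) => \sum_p ract (lact (v p) (m p)) b).

Fact free_lift_bilinear :
  bilinear_map (fun (v : F) (b : A) => \sum_p ract (lact (v p) (m p)) b).
Proof.
split=> [b|v]; apply: lin_bigsum => p c x y; last exact: ract_linear2.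
by rewrite !ffunE lact_linear1 ract_linear1.
Qed.

Lemma free_lift_pure v b : free_lift (pure v b) = \sum_p ract (lact (v p) (m p)) b.
Proof. exact: tens_lift_pure free_lift_bilinear. Qed.

Lemma free_lift_bihom : bihom free_lift.
Proof.
have L : linear free_lift by exact: tens_lift_linear free_lift_bilinear.
split=> // [a x|x a].
  move: x; apply: tens_ext; first exact: lin_comp L (free_lact_linear2 a).
    exact: lin_comp (lact_linear2 a) L.
  move=> v b; rewrite [lact _ _]free_lact_pure !free_lift_pure (lin_sum (lact_linear2 a)).
  by apply: eq_bigr => p _; rewrite ffunE lactM lact_ract.
move: x; apply: (tens_ext (f := fun x => free_lift (free_ract x a))).
- exact: lin_comp L (free_ract_linear1 a).
- exact: lin_comp (ract_linear1 a) L.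
move=> v b; rewrite free_ract_pure !free_lift_pure (lin_sum (ract_linear1 a)).
by apply: eq_bigr => p _; rewrite ractM.
Qed.

Lemma free_lift_generator p : free_lift (generator p) = m p.
Proof.
rewrite /generator free_lift_pure (bigD1 p) //= big1 => [|q qp].
  by rewrite ffunE eqxx lact1 ract1 addr0.
by rewrite ffunE (negPf qp) (lin0 (lact_linear1 _)) (lin0 (ract_linear1 _)).
Qed.

End Lift.

Lemma free_bihom_ext (M : bimodule A) (f g : free_bimodule -> M) :
  bihom f -> bihom g -> (forall p, f (generator p) = g (generator p)) -> f =1 g.
Proof.
move=> [fL fl fr] [gL gl gr] fg; apply: tens_ext => // v b.
rewrite pure_generators (lin_sum fL) (lin_sum gL); apply: eq_bigr => p _.
by rewrite fr gr fl gl fg.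
Qed.

Lemma free_biprojective : biprojective free_bimodule.
Proof.
move=> M N g f gH fH gsurj; have [m mP] := choice (fun p => gsurj (f (generator p))).
exists (free_lift m); first exact: free_lift_bihom.
apply: (free_bihom_ext (f := fun x => g (free_lift m x))) => // [|p].
  case: gH => gL gl gr; case: (free_lift_bihom m) => L l r'.
  by split=> [|a x|x a]; [exact: lin_comp|rewrite l gl|rewrite r' gr].
by rewrite free_lift_generator.
Qed.

Lemma free_finitely_generated : bi_finitely_generated free_bimodule.
Proof.
exists [seq generator p | p <- enum 'I_r]; apply: tens_ind => [|x y [s [sg ->]] [t [tg ->]]|v b].
- by exists [::]; rewrite big_nil.
- exists (s ++ t); rewrite big_cat; split=> // u.
  by rewrite mem_cat => /orP[/sg|/tg].
exists [seq (v p, generator p, b) | p <- enum 'I_r]; split=> [u|].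
  by case/mapP => p _ -> /=; apply: map_f; rewrite mem_enum.
by rewrite big_map big_enum /= pure_generators.
Qed.

End FreeBimodule.

Lemma free_bimodule0 (k : fieldType) (A : algType k) (x : free_bimodule A 0) : x = 0.
Proof.
move: x; apply: tens_ind => // [x y -> ->|v b]; first by rewrite addr0.
by rewrite pure_generators big_ord0.
Qed.

(** * Grading of free bimodules and reduction modulo A_+ *)

Section GradedFreeBimodule.
Variables (k : fieldType) (A : cgAlg k) (r : nat).
Local Notation F := {ffun 'I_r -> A}.
Local Notation B := (free_bimodule A r).

Lemma free_hom_ind (C : B -> Prop) : C 0 -> (forall x y, C x -> C y -> C (x + y)) ->
  (forall p i j a b, cg_comp i a -> cg_comp j b -> C (pure (single p a) b)) ->
  forall t, C t.
Proof.
move=> C0 CD Cp; apply: tens_ind => // v b.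
rewrite [v]single_sum (lin_sum (pure_linear1 b)); apply: big_ind => // p _.
have [M ->] := acomp_bound (v p); have [L ->] := acomp_bound b.
rewrite (lin_sum (single_linear p)) (lin_sum (pure_linear1 _)); apply: big_ind => // i _.
rewrite (lin_sum (pure_linear2 _)); apply: big_ind => // j _.
by apply: Cp; apply: acomp_in.
Qed.

Lemma free_hom_ext (U : lmodType k) (f g : B -> U) : linear f -> linear g ->
  (forall p i j a b, cg_comp i a -> cg_comp j b ->
    f (pure (single p a) b) = g (pure (single p a) b)) -> f =1 g.
Proof.
move=> fL gL fg; apply: free_hom_ind => // [|x y fx fy]; last by rewrite (linD fL) (linD gL) fx fy.
by rewrite !lin0.
Qed.

Definition fcomp (i : nat) (v : F) : F := [ffun p => acomp i (v p)].

Lemma fcomp_linear i : linear (fcomp i).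
Proof. by move=> c u v; apply/ffunP => p; rewrite !ffunE acomp_linear. Qed.

Lemma fcomp_single i p a : fcomp i (single p a) = single p (acomp i a).
Proof. by apply/ffunP => q; rewrite !ffunE; case: ifP; rewrite ?acomp0. Qed.

(** The component of total degree [m]. Generators sit in degree 0 at every step of the resolution,
    so a differential raises degree by the degree of its entries. *)
Definition bcomp (m : nat) (t : B) : B :=
  \sum_(i < m.+1) tens_lift (fun (v : F) (b : A) => pure (fcomp i v) (acomp (m - i) b)) t.

Fact bcomp_bilinear i j :
  bilinear_map (fun (v : F) (b : A) => pure (fcomp i v) (acomp j b)).
Proof.
split=> [b|v]; first exact: lin_comp (pure_linear1 _) (fcomp_linear i).
exact: lin_comp (pure_linear2 _) (@acomp_linear _ A j).
Qed.

Lemma bcomp_linear m : linear (bcomp m).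
Proof. by apply: lin_bigsum => i; apply/tens_lift_linear/bcomp_bilinear. Qed.

Lemma bcomp_single m p i j a b : cg_comp i a -> cg_comp j b ->
  bcomp m (pure (single p a) b) = if m == (i + j)%N then pure (single p a) b else 0.
Proof.
move=> ai bj; rewrite /bcomp.
have E (l : 'I_m.+1) :
    tens_lift (fun (v : F) (b : A) => pure (fcomp l v) (acomp (m - l) b)) (pure (single p a) b)
    = if (l == i :> nat) && (m == (i + j)%N) then pure (single p a) b else 0.
  rewrite (tens_lift_pure _ _ (bcomp_bilinear _ _)) fcomp_single (acomp_hom _ ai) (acomp_hom _ bj).
  have [li|li] /= := eqVneq (l : nat) i; last first.
    by rewrite (lin0 (single_linear p)) (lin0 (pure_linear1 _)).
  rewrite -[m == _](eqn_add2r (i)) -li.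
  have -> : (m + l == l + j + l)%N = (m - l == j)%N.
    by rewrite eqn_add2r -{1}(subnK (ltnSE (ltn_ord l))) addnC eqn_add2l.
  by case: ifP => // _; rewrite (lin0 (pure_linear2 _)).
rewrite (eq_bigr _ (fun l _ => E l)).
case: (altP (m =P (i + j)%N)) => mij; last by rewrite big1 // => l _; rewrite andbF.
have im : (i < m.+1)%N by rewrite mij ltnS leq_addr.
rewrite (bigD1 (Ordinal im)) //= eqxx big1 ?addr0 // => l li.
by rewrite andbT ifN //; apply: contra li => /eqP li; apply/eqP/val_inj.
Qed.

Definition bhom (m : nat) (t : B) : Prop :=
  forall l, bcomp l t = if l == m then t else 0.

Lemma bhom_single p i j a b : cg_comp i a -> cg_comp j b ->
  bhom (i + j) (pure (single p a) b).
Proof. by move=> ai bj l; apply: bcomp_single. Qed.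

Lemma bhom0 m : bhom m 0.
Proof. by move=> l; rewrite (lin0 (bcomp_linear l)); case: ifP. Qed.

Lemma bhomD m x y : bhom m x -> bhom m y -> bhom m (x + y).
Proof.
by move=> xm ym l; rewrite (linD (bcomp_linear l)) xm ym; case: ifP; rewrite ?addr0.
Qed.

Lemma bhom_bcomp m t : bhom m (bcomp m t).
Proof.
move: t; apply: free_hom_ind => [|x y xm ym|p i j a b ai bj].
- by rewrite (lin0 (bcomp_linear m)); apply: bhom0.
- by rewrite (linD (bcomp_linear m)); apply: bhomD.
rewrite (bcomp_single m p ai bj); case: ifP => [/eqP ->|_]; last exact: bhom0.
exact: bhom_single.
Qed.

Lemma bhom_lact m i a t : cg_comp i a -> bhom m t -> bhom (i + m) (lact a t).
Proof.
move=> ai tm; have -> : t = bcomp m t by rewrite tm eqxx.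
move: t {tm}; apply: free_hom_ind => [|x y xm ym|p j l c b cj bl].
- by rewrite (lin0 (bcomp_linear m)) (lin0 (lact_linear2 a)); apply: bhom0.
- by rewrite (linD (bcomp_linear m)) (linD (lact_linear2 a)); apply: bhomD.
rewrite (bcomp_single m p cj bl); case: ifP => [/eqP ->|_]; last first.
  by rewrite (lin0 (lact_linear2 a)); apply: bhom0.
rewrite [lact _ _]free_lact_pure lmul_single addnA; apply: bhom_single => //.
exact: cg_compM.
Qed.

Lemma bhom_ract m i a t : cg_comp i a -> bhom m t -> bhom (m + i) (ract t a).
Proof.
move=> ai tm; have -> : t = bcomp m t by rewrite tm eqxx.
move: t {tm}; apply: free_hom_ind => [|x y xm ym|p j l c b cj bl].
- by rewrite (lin0 (bcomp_linear m)) (lin0 (ract_linear1 a)); apply: bhom0.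
- by rewrite (linD (bcomp_linear m)) (linD (ract_linear1 a)); apply: bhomD.
rewrite (bcomp_single m p cj bl); case: ifP => [/eqP ->|_]; last first.
  by rewrite (lin0 (ract_linear1 a)); apply: bhom0.
rewrite [ract _ _]free_ract_pure -addnA; apply: bhom_single => //.
exact: cg_compM.
Qed.

Lemma bcomp_bound t : exists M, t = \sum_(m < M) bcomp m t.
Proof.
(* Asking for all larger bounds lets the bounds of two summands be combined. *)
suff [M H] : exists M, forall L, (M <= L)%N -> t = \sum_(m < L) bcomp m t by exists M; apply: H.
move: t; apply: free_hom_ind => [|x y [M xM] [L yL]|p i j a b ai bj].
- by exists 0%N => L _; rewrite big1 // => m _; rewrite (lin0 (bcomp_linear m)).
- exists (maxn M L) => K; rewrite geq_max => /andP[MK LK].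
  rewrite {1}(xM _ MK) {1}(yL _ LK) -big_split; apply: eq_bigr => m _.
  by rewrite (linD (bcomp_linear m)).
exists (i + j).+1 => L ijL; rewrite (bigD1 (Ordinal ijL)) //= (bcomp_single _ _ ai bj) eqxx.
rewrite big1 ?addr0 // => m mij; rewrite (bcomp_single _ _ ai bj) ifN //.
Qed.

Definition bvanishes_below (p : nat) (t : B) : Prop :=
  forall m, (m < p)%N -> bcomp m t = 0.

Lemma bvanishes_belowS p t a : bvanishes_below p t -> cg_aug A a = 0 ->
  bvanishes_below p.+1 (ract t a).
Proof.
move=> tp a0 m mp; have [M ->] := bcomp_bound t; have [L ->] := acomp_bound a.
rewrite (lin_sum (ract_linear1 _)) (lin_sum (bcomp_linear m)) big1 // => i _.
rewrite (lin_sum (ract_linear2 _)) (lin_sum (bcomp_linear m)) big1 // => j _.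
have [ip|pi] := ltnP i p; first by rewrite tp // (lin0 (ract_linear1 _)) (lin0 (bcomp_linear m)).
have [j0|j0] := posnP j.
  by rewrite j0 acomp0E a0 scale0r (lin0 (ract_linear2 _)) (lin0 (bcomp_linear m)).
rewrite (bhom_ract (acomp_in j a) (bhom_bcomp i t)) ltn_eqF //.
by rewrite (leq_trans mp) // -addn1 leq_add.
Qed.

(* [reduct t] is the class of t in (F (x) A) (x)_A k = F. *)
Definition reduct : B -> F := tens_lift (fun (v : F) (b : A) => cg_aug A b *: v).

Fact reduct_bilinear : bilinear_map (fun (v : F) (b : A) => cg_aug A b *: v).
Proof.
split=> [b|v] c x y; first by rewrite scalerDr !scalerA mulrC.
have -> : cg_aug A (c *: x + y) = c * cg_aug A x + cg_aug A y.
  by rewrite rmorphD -mulr_algl rmorphM cg_aug_scalar.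
by rewrite scalerDl scalerA.
Qed.

Lemma reduct_linear : linear reduct.
Proof. exact: tens_lift_linear reduct_bilinear. Qed.

Lemma reduct_pure v b : reduct (pure v b) = cg_aug A b *: v.
Proof. exact: tens_lift_pure reduct_bilinear. Qed.

Lemma reduct_lact a t : reduct (lact a t) = lmul a (reduct t).
Proof.
move: t; apply: tens_ext; first exact: lin_comp reduct_linear (lact_linear2 a).
  exact: lin_comp (lmul_linear2 a) reduct_linear.
by move=> v b; rewrite [lact _ _]free_lact_pure !reduct_pure (linZ (lmul_linear2 a)).
Qed.

Lemma reduct_ract t a : reduct (ract t a) = cg_aug A a *: reduct t.
Proof.
move: t; apply: (tens_ext (f := fun t : B => reduct (ract t a))).
- exact: lin_comp reduct_linear (ract_linear1 a).
- exact: lin_scale reduct_linear.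
by move=> v b; rewrite [ract _ _]free_ract_pure !reduct_pure rmorphM scalerA mulrC.
Qed.

Lemma reduct_bcomp m t : reduct (bcomp m t) = fcomp m (reduct t).
Proof.
move: t; apply: free_hom_ext; first exact: lin_comp reduct_linear (bcomp_linear m).
  exact: lin_comp (fcomp_linear m) reduct_linear.
move=> p i j a b ai bj; rewrite (bcomp_single m p ai bj) reduct_pure.
rewrite (linZ (fcomp_linear m)) fcomp_single (acomp_hom m ai).
have [j0|j0] := eqVneq j 0%N.
  rewrite j0 addn0; case: eqP => _; first by rewrite reduct_pure.
  by rewrite (lin0 reduct_linear) (lin0 (single_linear p)) scaler0.
rewrite (cg_aug_hom bj j0) !scale0r; case: eqP => _; last exact: lin0 reduct_linear.
by rewrite reduct_pure (cg_aug_hom bj j0) scale0r.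
Qed.

(** The kernel of [reduct] is B A_+: on a pure tensor, split the right factor into its scalar part
    and an element of A_+. *)
Lemma reduct_kernel t : exists s : seq (B * A),
  (forall u, u \in s -> cg_aug A u.2 = 0) /\
  t = pure (reduct t) 1 + \sum_(u <- s) ract u.1 u.2.
Proof.
move: t; apply: tens_ind => [|x y [s [s0 xs]] [t [t0 yt]]|v b].
- by exists [::]; rewrite (lin0 reduct_linear) (lin0 (pure_linear1 _)) big_nil addr0.
- exists (s ++ t); split=> [u|]; first by rewrite mem_cat => /orP[/s0|/t0].
  by rewrite big_cat (linD reduct_linear) (linD (pure_linear1 _)) addrACA -xs -yt.
exists [:: (pure v 1 : B, b - (cg_aug A b)%:A)]; split=> [u|].
  by rewrite inE => /eqP -> /=; rewrite rmorphB cg_aug_scalar subrr.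
rewrite big_seq1 [ract _ _]free_ract_pure mul1r reduct_pure.
rewrite (linZ (pure_linear1 _)) -(linZ (pure_linear2 _)) -(linD (pure_linear2 _)).
by rewrite addrC subrK.
Qed.

End GradedFreeBimodule.

(** * Resolution of A by free bimodules *)

Section Syzygies.
Variables (k : fieldType) (A : cgAlg k).

Lemma bihom_bhom r r' (d : free_bimodule A r' -> free_bimodule A r) deg m y :
  bihom d -> (forall p, bhom deg (d (generator A p))) ->
  bhom m y -> bhom (m + deg) (d y).
Proof.
move=> [dL dl dr] dg ym; have -> : y = bcomp m y by rewrite ym eqxx.
move: y {ym}; apply: free_hom_ind => [|x y xm ym|p i j a b ai bj].
- by rewrite (lin0 (bcomp_linear m)) (lin0 dL); apply: bhom0.
- by rewrite (linD (bcomp_linear m)) (linD dL); apply: bhomD.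
rewrite (bcomp_single m p ai bj); case: ifP => [/eqP ->|_]; last first.
  by rewrite (lin0 dL); apply: bhom0.
have -> : pure (single p a) b = ract (lact a (generator A p)) b.
  by rewrite [lact _ _]free_lact_pure [RHS]free_ract_pure lmul_single mulr1 mul1r.
by rewrite dr dl addnAC; apply: (bhom_ract bj (bhom_lact ai (dg p))).
Qed.

Lemma bihom_bcomp r r' (d : free_bimodule A r' -> free_bimodule A r) deg m y :
  bihom d -> (forall p, bhom deg (d (generator A p))) ->
  bcomp (m + deg) (d y) = d (bcomp m y).
Proof.
move=> dH dg; have [dL _ _] := dH; have [M ->] := bcomp_bound y.
rewrite (lin_sum (bcomp_linear m)) !(lin_sum dL) (lin_sum (bcomp_linear _)).
apply: eq_bigr => i _.
rewrite (bihom_bhom dH dg (bhom_bcomp i y)) (bhom_bcomp i y) eqn_add2r.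
by case: eqP => // _; rewrite (lin0 dL).
Qed.

(* [K] is a graded sub-bimodule of a free bimodule, split off on the right by  *)
(* the projector [e], and [Z] is its image [K (x)_A k].                       *)
Record syzygy r (Z : {ffun 'I_r -> A} -> Prop) (K : free_bimodule A r -> Prop)
    (e : free_bimodule A r -> free_bimodule A r) : Prop := Syzygy {
  syz0 : K 0;
  syzP : forall (c : k) x y, K x -> K y -> K (c *: x + y);
  syz_lact : forall a x, K x -> K (lact a x);
  syz_ract : forall x a, K x -> K (ract x a);
  syz_bcomp : forall m x, K x -> K (bcomp m x);
  syz_lin : linear e;
  syz_eR : forall x a, e (ract x a) = ract (e x) a;
  syz_eK : forall x, K (e x);
  syz_id : forall x, K x -> e x = x;
  syz_reduct : forall v, Z v <-> exists2 x, K x & reduct x = v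
}.

Lemma syz_sum r Z K e (H : @syzygy r Z K e) (J : eqType) (s : seq J)
    (f : J -> free_bimodule A r) :
  (forall i, i \in s -> K (f i)) -> K (\sum_(i <- s) f i).
Proof.
move=> Kf; rewrite big_seq; apply: big_ind => //; first exact: syz0 H.
by move=> x y Kx Ky; rewrite -[x]scale1r; apply: (syzP H).
Qed.

Lemma syzB r Z K e (H : @syzygy r Z K e) x y : K x -> K y -> K (x - y).
Proof. by move=> Kx Ky; rewrite addrC -scaleN1r; apply: (syzP H). Qed.

(* For z in K, an x with reduct (d x) = reduct z gives z - d x in K A_+, since  *)
(* [e] carries a representation in B A_+ into one in K A_+; iterating, z is     *)
(* approximated by elements of d up to any degree.                              *)
Lemma syzygy_cover r r' Z K e (H : @syzygy r Z K e) deg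
    (d : free_bimodule A r' -> free_bimodule A r) :
  bihom d -> (forall x, K (d x)) ->
  (forall p, bhom deg (d (generator A p))) ->
  (forall v, Z v -> exists x, reduct (d x) = v) ->
  forall z, K z -> exists y, d y = z.
Proof.
move=> dH dK dg dZ; have [dL dl dr] := dH.
have approx p : forall z, K z -> exists y, bvanishes_below p (z - d y).
  elim: p => [z _|p IH z Kz]; first by exists 0.
  have [x xz] : exists x, reduct (d x) = reduct z by apply/dZ/(syz_reduct H); exists z.
  have Kw : K (z - d x) by apply: (syzB H).
  have w0 : reduct (z - d x) = 0 by rewrite (linB (@reduct_linear _ _ _)) xz subrr.
  have [s [s0 ws]] := reduct_kernel (z - d x).
  rewrite w0 (lin0 (pure_linear1 _)) add0r in ws.
  have {}ws : z - d x = \sum_(u <- s) ract (e u.1) u.2.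
    rewrite -(syz_id H Kw) {1}ws (lin_sum (syz_lin H)).
    by apply: eq_bigr => u _; rewrite (syz_eR H).
  have /choice[f fP] : forall u : free_bimodule A r * A,
      exists y, bvanishes_below p (e u.1 - d y).
    by move=> u; apply: IH; apply: (syz_eK H).
  exists (x + \sum_(u <- s) ract (f u) u.2); move=> m mp.
  have -> : z - d (x + \sum_(u <- s) ract (f u) u.2) =
      \sum_(u <- s) ract (e u.1 - d (f u)) u.2.
    rewrite (linD dL) opprD addrA ws (lin_sum dL) -sumrB; apply: eq_bigr => u _.
    by rewrite dr (linB (ract_linear1 _)).
  rewrite (lin_sum (bcomp_linear m)) big_seq big1 // => u us.
  exact: (bvanishes_belowS (fP u) (s0 u us) mp).
have comp_image m y : exists y', d y' = bcomp m (d y).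
  have [M ->] := bcomp_bound y; rewrite (lin_sum dL) (lin_sum (bcomp_linear m)).
  apply: (big_ind (fun x => exists y', d y' = x)) => [|_ _ [u' <-] [v' <-]|i _].
  - by exists 0; rewrite (lin0 dL).
  - by exists (u' + v'); rewrite (linD dL).
  rewrite (bihom_bhom dH dg (bhom_bcomp i y)); case: ifP => _; first by eexists.
  by exists 0; rewrite (lin0 dL).
(* All components of [z] lie below degree M, where they agree with those of [d y]; the image of [d]
   is closed under components. *)
move=> z Kz; have [M zM] := bcomp_bound z; have [y yz] := approx M z Kz.
rewrite zM; apply: (big_ind (fun x => exists y', d y' = x)) => [|_ _ [u' <-] [v' <-]|i _].
- by exists 0; rewrite (lin0 dL).
- by exists (u' + v'); rewrite (linD dL).
have [y' ey] := comp_image i y; exists y'; rewrite ey.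
apply/eqP; rewrite eq_sym -subr_eq0 -(linB (bcomp_linear _)).
by apply/eqP/yz.
Qed.

(** As a right module F (x) A is induced from the vector space F, so it suffices to lift linearly
    over k on F, by [linear_lifting], and extend. *)
Lemma right_linear_lift r r' (d : free_bimodule A r' -> free_bimodule A r)
    (e : free_bimodule A r -> free_bimodule A r) :
  bihom d -> linear e -> (forall x a, e (ract x a) = ract (e x) a) ->
  (forall x, exists y, d y = e x) ->
  exists s : free_bimodule A r -> free_bimodule A r',
    [/\ linear s, forall x a, s (ract x a) = ract (s x) a & forall x, d (s x) = e x].
Proof.
move=> [dL dl dr] eL eR de.
have [|v|u uL uP] := linear_lifting (f := fun v => e (pure v 1)) dL.
- exact: lin_comp eL (pure_linear1 1).
- exact: de.
have bil : bilinear_map (fun v b => ract (u v) b).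
  by split=> [b|v]; [exact: lin_comp (ract_linear1 b) uL|exact: ract_linear2].
pose s : free_bimodule A r -> free_bimodule A r' := tens_lift (fun v b => ract (u v) b).
have sL : linear s by exact: tens_lift_linear bil.
have s_pure v b : s (pure v b) = ract (u v) b by exact: tens_lift_pure bil.
exists s; split=> // [x a|x].
  move: x; apply: (tens_ext (f := fun x : free_bimodule A r => s (ract x a))).
  - exact: lin_comp sL (ract_linear1 a).
  - exact: lin_comp (ract_linear1 a) sL.
  by move=> v b; rewrite [ract _ _]free_ract_pure !s_pure ractM.
move: x; apply: tens_ext => //; first exact: lin_comp dL sL.
move=> v b; rewrite s_pure dr uP -eR [ract _ _]free_ract_pure.
by rewrite mul1r.
Qed.

(** The rows of [D] lift to generators of K. A right linear [s] with [d s = e] then splits off the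
    new kernel, with projector [y - s (d y)], and the situation reproduces itself one step up. *)
Lemma syzygy_step r r' (D : 'I_r' -> 'I_r -> A) deg Z K e :
  @syzygy r Z K e -> (forall p q, cg_comp deg (D p q)) ->
  (forall v, Z v <-> exists y, rowmul D y = v) ->
  exists (d : free_bimodule A r' -> free_bimodule A r) K' e',
    [/\ bihom d, forall x, K x <-> exists y, d y = x,
        forall y, K' y <-> d y = 0
      & syzygy (fun v => rowmul D v = 0) K' e'].
Proof.
move=> H Dhom ZD.
(* A row of [D] is the image of a unit vector, hence lies in [Z]. Passing to the component of degree
   [deg] leaves its reduction unchanged. *)
have gP p : exists g, [/\ K g, bhom deg g & reduct g = [ffun q => D p q]].
  have [|x Kx xD] := (syz_reduct H [ffun q => D p q]).1.
    apply/ZD; exists (single p 1); apply/ffunP => q; rewrite !ffunE (bigD1 p) //=.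
    rewrite big1 => [|p' pp']; first by rewrite ffunE eqxx mul1r addr0.
    by rewrite ffunE (negPf pp') mul0r.
  exists (bcomp deg x); split; [exact: (syz_bcomp H)|exact: bhom_bcomp|].
  rewrite reduct_bcomp xD; apply/ffunP => q; rewrite !ffunE.
  exact: acomp_id.
have [g {}gP] := choice gP.
pose d := free_lift g; have dH : bihom d := free_lift_bihom g.
have [dL dl dr] := dH.
have dg p : bhom deg (d (generator A p)) by rewrite /d free_lift_generator; case: (gP p).
have dK x : K (d x).
  move: x; apply: tens_ind => [|x y Kx Ky|v b].
  - by rewrite (lin0 dL); apply: (syz0 H).
  - by rewrite (linD dL) -[d x]scale1r; apply: (syzP H).
  rewrite /d free_lift_pure; apply: (syz_sum H) => p _.
  by apply/(syz_ract H)/(syz_lact H); case: (gP p).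
have d_reduct x : reduct (d x) = rowmul D (reduct x).
  have RL : linear (rowmul D).
    move=> c u v; apply/ffunP => q; rewrite !ffunE scaler_sumr -big_split.
    by apply: eq_bigr => p _; rewrite !ffunE mulrDl scalerAl.
  move: x; apply: tens_ext; first exact: lin_comp (@reduct_linear _ _ _) dL.
    exact: lin_comp RL (@reduct_linear _ _ _).
  move=> v b; rewrite /d free_lift_pure (lin_sum (@reduct_linear _ _ _)) reduct_pure.
  rewrite (linZ RL) /rowmul; apply/ffunP => q; rewrite sum_ffunE !ffunE scaler_sumr.
  by apply: eq_bigr => p _; have [_ _ gD] := gP p; rewrite reduct_ract reduct_lact gD !ffunE.
have im_d x : K x <-> exists y, d y = x.
  split=> [|[y <-] //]; apply: (syzygy_cover H dH dK dg) => v /ZD[y <-].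
  by exists (pure y 1); rewrite d_reduct reduct_pure rmorph1 scale1r.
have [x|s [sL sR ds]] := right_linear_lift dH (syz_lin H) (syz_eR H).
  by apply/im_d/(syz_eK H).
have ds_d y : d (s (d y)) = d y by rewrite ds (syz_id H).
exists d, (fun y => d y = 0), (fun y => y - s (d y)); split=> //.
split=> [|c x y dx dy|a x dx|x a dx|m x dx||x a|x|x dx|v].
- exact: lin0.
- by rewrite dL dx dy scaler0 addr0.
- by rewrite dl dx (lin0 (lact_linear2 _)).
- by rewrite dr dx (lin0 (ract_linear1 _)).
- by rewrite -(bihom_bcomp m x dH dg) dx (lin0 (bcomp_linear _)).
- move=> c x y; rewrite dL sL scalerBr opprD addrACA; exact.
- by rewrite dr sR (linB (ract_linear1 _)).
- by rewrite (linB dL) ds_d subrr.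
- by rewrite dx (lin0 sL) subr0.
split=> [v0|[x dx <-]]; last by rewrite -d_reduct dx (lin0 (@reduct_linear _ _ _)).
(* The naive lift of [v] need not be a cycle, but [d x] reduces to 0 and so lies in B A_+. By right
   linearity [s (d x)] also reduces to 0, so subtracting it corrects [x] without changing the
   reduction. *)
pose x := pure v 1 : free_bimodule A r'.
have xv : reduct x = v by rewrite reduct_pure rmorph1 scale1r.
have [t [t0 dt]] := reduct_kernel (d x).
rewrite d_reduct xv v0 (lin0 (pure_linear1 _)) add0r in dt.
exists (x - s (d x)); first by rewrite (linB dL) ds_d subrr.
rewrite (linB (@reduct_linear _ _ _)) xv dt (lin_sum sL) (lin_sum (@reduct_linear _ _ _)).
rewrite big_seq big1 ?subr0 // => u us.
by rewrite sR reduct_ract t0 // scale0r.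
Qed.

End Syzygies.

Section BimoduleResolution.
Variables (k : fieldType) (A : cgAlg k).

Definition free_mult r : free_bimodule A r -> regular A :=
  free_lift (M := regular A) (fun _ => 1 : A).

(** Multiplication A (x) A -> A is split on the right by a |-> 1 (x) a, and its kernel reduces to
    A_+. *)
Lemma syzygy_base r (top : 'I_r) : (forall p, p = top) ->
  exists K e, (forall x, K x <-> @free_mult r x = 0) /\
    syzygy (fun v : {ffun 'I_r -> A} => cg_aug A (v top) = 0) K e.
Proof.
move=> topE; pose mu := @free_mult r.
have [muL mul mur] : bihom mu := free_lift_bihom _.
have mu_pure v b : mu (pure v b) = v top * b.
  rewrite /mu /free_mult free_lift_pure (bigD1 top) //= big1 ?addr0 ?mulr1 // => p.
  by rewrite (topE p) eqxx.
pose s (a : A) : free_bimodule A r := pure (single top 1) a.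
have sL : linear s by exact: pure_linear2.
have sR a b : s (a * b) = ract (s a) b by rewrite /s [ract _ _]free_ract_pure.
have mus a : mu (s a) = a by rewrite mu_pure ffunE eqxx mul1r.
have mu_bcomp m x : mu (bcomp m x) = acomp m (mu x : A).
  move: x; apply: free_hom_ext; first exact: lin_comp muL (bcomp_linear m).
    exact: lin_comp (@acomp_linear _ A m) muL.
  move=> p i j a b ai bj; rewrite (bcomp_single m p ai bj) mu_pure.
  rewrite (topE p) ffunE eqxx (acomp_hom m (cg_compM ai bj)).
  by case: ifP => _; rewrite ?(lin0 muL) // mu_pure ffunE eqxx.
have mu_aug x : cg_aug A (reduct x top) = cg_aug A (mu x : A).
  move: x; apply: tens_ind => [|x y ex ey|v b].
  - by rewrite (lin0 (@reduct_linear _ _ _)) (lin0 muL) ffunE.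
  - by rewrite (linD (@reduct_linear _ _ _)) (linD muL) ffunE !rmorphD ex ey.
  rewrite reduct_pure mu_pure ffunE -mulr_algl !rmorphM cg_aug_scalar.
  by rewrite mulrC.
exists (fun x => mu x = 0), (fun x => x - s (mu x)); split=> //.
split=> [|c x y dx dy|a x dx|x a dx|m x dx||x a|x|x dx|v].
- exact: lin0.
- by rewrite muL dx dy scaler0 addr0.
- by rewrite mul dx (lin0 (lact_linear2 _)).
- by rewrite mur dx (lin0 (ract_linear1 _)).
- by rewrite mu_bcomp dx acomp0.
- move=> c x y; rewrite muL sL scalerBr opprD addrACA; exact.
- by rewrite mur [s _]sR (linB (ract_linear1 _)).
- by rewrite (linB muL) mus subrr.
- by rewrite dx (lin0 sL) subr0.
split=> [v0|[x dx <-]]; last by rewrite mu_aug dx rmorph0.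
exists (pure v 1 - s (v top)); first by rewrite (linB muL) mus mu_pure mulr1 subrr.
by rewrite (linB (@reduct_linear _ _ _)) !reduct_pure v0 rmorph1 scale1r scale0r subr0.
Qed.

Lemma bimodule_resolution (F : free_resolution A) :
  exists P : biresolution A, forall i, P i = free_bimodule A (fr_rank F i).
Proof.
pose B i := free_bimodule A (fr_rank F i).
pose Z i : {ffun 'I_(fr_rank F i) -> A} -> Prop := match i with
  | 0 => fun v => cg_aug A (v (fr_top F)) = 0
  | j.+1 => fun v => rowmul (@fr_mx _ _ F j) v = 0 end.
have ZD i v : Z i v <-> exists y, rowmul (@fr_mx _ _ F i) y = v.
  by case: i v => [|i] v; [apply: fr_exact0|apply: fr_exact].
pose T i := ((B i -> Prop) * (B i -> B i))%type.
pose C i : T i -> Prop := fun u => syzygy (@Z i) u.1 u.2 /\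
  (match i return T i -> Prop with
   | 0 => fun u => forall x, u.1 x <-> free_mult x = 0 | _ => fun _ => True end) u.
(* The recursion carries only a kernel and its projector; the differentials linking consecutive
   kernels are extracted afterwards. *)
pose Rel i (u : T i) (v : T i.+1) := exists d : B i.+1 -> B i,
  [/\ bihom d, forall x, u.1 x <-> exists y, d y = x & forall y, v.1 y <-> d y = 0].
have [||u [uC uR]] := @dependent_choice T C Rel.
- by have [K [e [K0 S]]] := syzygy_base (@fr_topE _ _ F); exists (K, e).
- move=> i [K e] [/= S _].
  have [d [K' [e' [dH dK K'0 S']]]] := syzygy_step S (@fr_hom _ _ F i) (ZD i).
  by exists (K', e'); [split|exists d].
pose d i := sval (cid (uR i)).
have dP i : [/\ bihom (d i), forall x, (u i).1 x <-> exists y, d i y = x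
  & forall y, (u i.+1).1 y <-> d i y = 0] := svalP (cid (uR i)).
have dH i : bihom (d i) by case: (dP i).
have surj x : exists y, @free_mult (fr_rank F 0) y = x.
  exists (pure (single (fr_top F) 1) x).
  rewrite /free_mult free_lift_pure (bigD1 (fr_top F)) //= big1 => [|p].
    by rewrite ffunE eqxx !mul1r addr0.
  by rewrite (fr_topE p) eqxx.
have ex0 x : @free_mult (fr_rank F 0) x = 0 <-> exists y, d 0%N y = x.
  have [_ H _] := dP 0%N; rewrite -H; have [_ ->] := uC 0%N; exact: iff_refl.
have ex i x : d i x = 0 <-> exists y, d i.+1 y = x.
  have [_ _ <-] := dP i; have [_ H _] := dP i.+1; exact: H.
by exists (@Biresolution k A B d (@free_mult _) dH (free_lift_bihom _)
  (fun i => @free_biprojective k A _) surj ex0 ex).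
Qed.

End BimoduleResolution.

(** * Comparison of identifications of Ext, and the twist *)

Section InnerStructure.
Variables (k : fieldType) (A : algType k).

Lemma tens_map_pure (f g : A -> A) x y : linear f -> linear g ->
  tens_map f g (pure x y) = pure (f x) (g y) :> tens A A.
Proof.
by move=> fL gL; rewrite /tens_map tens_lift_pure //; apply: bilinear_comp (pure_bilinear A A).
Qed.

Lemma tens_map_comm (f g f' g' : A -> A) (t : tens A A) :
  linear f -> linear g -> linear f' -> linear g' ->
  (forall x, f (f' x) = f' (f x)) -> (forall x, g (g' x) = g' (g x)) ->
  tens_map f g (tens_map f' g' t) = tens_map f' g' (tens_map f g t).
Proof.
move=> fL gL fL' gL' ff gg; move: t.
by apply: tens_ext => [||x y]; do ?[exact: lin_comp (tens_map_linear _ _) (tens_map_linear _ _)];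
  rewrite !tens_map_pure // ff gg.
Qed.

Variable P : biresolution A.
Local Notation cocycle := (is_cocycle (@bres_d _ _ P) (@bicochain _ _ P)).

Lemma cocycleB i (f g : P i -> tens A A) :
  cocycle f -> cocycle g -> cocycle (fun x => f x - g x).
Proof.
move=> [[fL fl fr] fd] [[gL gl gr] gd]; split=> [|y]; last by rewrite fd gd subrr.
split=> [c x y|a x|x a].
- by rewrite fL gL scalerBr opprD addrACA.
- by rewrite fl gl (linB (lact_linear2 a)).
- by rewrite fr gr (linB (ract_linear1 a)).
Qed.

Lemma cocycle_tens_map i (f : P i -> tens A A) (g h : A -> A) :
  linear g -> linear h -> (forall a x, g (a * x) = a * g x) ->
  (forall a x, h (x * a) = h x * a) -> cocycle f -> cocycle (fun x => tens_map g h (f x)).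
Proof.
move=> gL hL ga ha [[fL fl fr] fd]; have TL := tens_map_linear gL hL.
split=> [|y]; last by rewrite fd (lin0 TL).
split=> [|a x|x a]; first exact: lin_comp TL fL.
- rewrite fl; apply: tens_map_comm => //; exact: mull_linear.
- rewrite fr; apply: tens_map_comm => //; exact: mulr_linear'.
Qed.

Lemma cocycle_linner i a (f : P i -> tens A A) : cocycle f -> cocycle (fun x => linner a (f x)).
Proof. by apply: cocycle_tens_map => // [|b x]; [exact: mull_linear|rewrite mulrA]. Qed.

Lemma cocycle_rinner i a (f : P i -> tens A A) : cocycle f -> cocycle (fun x => rinner (f x) a).
Proof. by apply: cocycle_tens_map => // [|b x]; [exact: mulr_linear'|rewrite mulrA]. Qed.

(** Both maps have the coboundaries as kernel on cocycles, hence the same fibres; this replaces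
    composing one isomorphism with the inverse of the other. *)
Lemma biExt_iso_eq i E E' (th : (P i -> tens A A) -> bi_car E)
    (th' : (P i -> tens A A) -> bi_car E') f g :
  biExt_iso th -> biExt_iso th' -> cocycle f -> cocycle g ->
  th f = th g -> th' f = th' g.
Proof.
move=> [[thD _ th0] _ _] [[thD' _ th0'] _ _] cf cg efg.
have cfg := cocycleB cf cg.
have fE : f = (fun x => (f x - g x) + g x) by apply/funext => x; rewrite subrK.
have z : th (fun x => f x - g x) = 0.
  by move: efg; rewrite {1}fE thD // -[RHS]add0r => /addIr.
by rewrite fE thD' // (th0' _ cfg).2 ?add0r //; apply/(th0 _ cfg).
Qed.

End InnerStructure.

Section Twist.
Variables (k : fieldType) (A : cgAlg k).

(* [u] is the image of 1 under the isomorphism A ~ _psi A.                      *)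
Lemma twisted_iso (P : biresolution A) i (psi : {lrmorphism A -> A})
    (th : (P i -> tens A A) -> regular A) (th' : (P i -> tens A A) -> twisted psi) :
  biExt_iso th -> biExt_iso th' ->
  exists2 u : A, cg_aug A u != 0 & forall a, psi a * u = u * a.
Proof.
move=> I I'; have [[_ ths _] thl thr] := I; have [[_ ths' _] thl' thr'] := I'.
have [x0 c0 e0] := ths (1 : A).
have [y0 d0 f0] := ths' (1 : A).
exists (th' x0 : A) => [|a].
  (* Since [x0] corresponds to 1 in A, the class of [y0] is [th y0] times that of [x0]. Applying
     [th'] gives 1 = psi([th y0]) u. *)
  have E : th y0 = th (fun x => linner (th y0 : A) (x0 x)).
    by rewrite thl // e0 /= mulr1.
  have := biExt_iso_eq I I' d0 (cocycle_linner (th y0 : A) c0) E.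
  rewrite f0 thl' //= => e1; apply/eqP => u0; have := oner_neq0 k.
  by rewrite -(rmorph1 (cg_aug A)) e1 rmorphM u0 mulr0 eqxx.
(* In A itself a 1 = 1 a; carried over by [th'] this is psi(a) u = u a. *)
have E : th (fun x => linner a (x0 x)) = th (fun x => rinner (x0 x) a).
  by rewrite thl // thr // e0 /= mulr1 mul1r.
have := biExt_iso_eq I I' (cocycle_linner a c0) (cocycle_rinner a c0) E.
by rewrite thl' // thr'.
Qed.

(* In the lowest degree of psi(a) u = u a, the factor u contributes the scalar  *)
(* cg_aug u.                                                                   *)
Lemma twist_trivial (psi : {lrmorphism A -> A}) (u : A) :
  (forall i a, cg_comp i a -> cg_comp i (psi a)) -> cg_aug A u != 0 ->
  (forall a, psi a * u = u * a) -> forall a, psi a = a.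
Proof.
move=> psiG u0 comm; apply: (eq_on_homogeneous (cg_decomposition A)) => [x y|x y|i a ai] //.
  exact: raddfD.
pose c := cg_aug A u; pose w := u - c%:A.
have w1 : vanishes_below 1 w by apply: vanishes_below1; rewrite rmorphB cg_aug_scalar subrr.
have below (b : A) : cg_comp i b -> vanishes_below i b.
  by move=> bi j ji; rewrite (acomp_hom j bi) ltn_eqF.
have uE : u = c%:A + w by rewrite addrC subrK.
have E1 : acomp i (psi a * u) = c *: psi a.
  rewrite uE mulrDr (linD (@acomp_linear _ A i)) mulr_algr.
  rewrite (vanishes_belowM (below _ (psiG _ _ ai)) w1 (i := i)) ?addn1 // addr0.
  by apply/acomp_id/cg_compZ/psiG.
have E2 : acomp i (u * a) = c *: a.
  rewrite uE mulrDl (linD (@acomp_linear _ A i)) mulr_algl.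
  rewrite (vanishes_belowM w1 (below _ ai) (i := i)) // addr0.
  by apply/acomp_id/cg_compZ.
by apply: (scalerI u0); rewrite -[LHS]E1 -[RHS]E2 comm.
Qed.

Lemma lrpow_hom (eps : {lrmorphism A -> A}) m i a : is_epsilon eps ->
  cg_comp i a -> cg_comp i (lrpow eps m a).
Proof.
move=> epsE; elim: m a => [//|m IH] a ai /=; rewrite (epsE i); last exact: IH.
have -> : ((-1) ^+ i : A) = ((-1) ^+ i : k)%:A by rewrite -in_algE rmorph_sign.
by rewrite mulr_algl; apply/cg_compZ/IH.
Qed.

End Twist.

Theorem proposition4p5 (k : fieldType) (A : cgAlg k) (N n : nat)
    (eps phi : {lrmorphism A -> A}) :
  Berger_Marconnet k ->
  (1 < N)%N -> N_Koszul A N -> AS_Gorenstein A n ->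
  is_epsilon eps -> is_phi n phi ->
  (Calabi_Yau A <-> forall a : A, lrpow eps n.+1 (phi a) = a).
Proof.
move=> BM N1 Kos Gor epsE phiE.
have {}BM := BM A N n eps phi N1 Kos Gor epsE phiE.
split=> [[d [d0 [P [_ _ _ [th thI]]]]]|psi1].
  have [van [th' [thI' _]]] := BM P.
  (* Otherwise Ext^d would vanish, although it contains a class corresponding to 1. *)
  have dn : d = n.
    apply: contrapT => /eqP dn; have [[_ ths th0] _ _] := thI.
    have [f cf ef] := ths (1 : A).
    have : th f = 0 by apply/(th0 f cf)/van.
    by rewrite ef => /eqP; rewrite oner_eq0.
  subst d; have [u u0 comm] := twisted_iso thI thI'.
  apply: (twist_trivial (psi := lrpow eps n.+1 \o phi)) u0 comm => i a ai.
  by apply: lrpow_hom => //; case: phiE => -[_ + _]; apply.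
have [presA [Q [G [gQ minQ genQ]]]] := Kos.
have [n0 [gld _] _] := Gor.
have [F F0] := koszul_free_resolution N1 presA gQ minQ genQ gld.
have [P PE] := bimodule_resolution F.
have [van [th [[[thD ths th0] thl thr] _]]] := BM P.
exists n; split=> //; exists P; split=> //.
- by exists n => i ni; rewrite PE F0 //; apply: free_bimodule0.
- by move=> i; rewrite PE; apply: free_finitely_generated.
exists th; split=> //.
(* _psi A and A differ only in the left action, where psi = id makes them agree. *)
by move=> f a cf; rewrite thl //; apply: (congr1 ( *%R^~ (th f : A)) (psi1 a)).
Qed.
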